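(* Suppose that $\xi_1(L),\dots,\xi_q(L)$ is a family of ``random variables'' (given by their joint ``moments'') depending on a parameter $L$, satisfying the structural assumptions (1)--(7) and the nested-contour moment formula stated in the context. Then, as $L\to\infty$, the ``random vector'' $$\frac{\xi_1(L)-\mathbb E\xi_1(L)}{c_L(1)L^{-\gamma/2}},\ \dots,\ \frac{\xi_q(L)-\mathbb E\xi_q(L)}{c_L(q)L^{-\gamma/2}}$$ converges (in the sense of ``moments'') to the Gaussian random vector $\zeta_1,\dots,\zeta_q$ with mean $0$ and covariance, for $k\le r$, $$\mathbb E\zeta_k\zeta_r=\oint\cdots\oint\mathfrak{Cr}^{k,r}(u^1_1,\dots,u^1_{l(k)};u^2_1,\dots,u^2_{l(r)})\,\mathfrak F^k(u^1_1,\dots,u^1_{l(k)})\,\mathfrak F^r(u^2_1,\dots,u^2_{l(r)})\,du^1_1\cdots du^1_{l(k)}\,du^2_1\cdots du^2_{l(r)},$$ where the integration goes over $\boldsymbol\gamma\in\aleph_{(k,r)}$. The answer does not depend on the choice of $\boldsymbol\gamma\in\aleph_{(k,r)}$.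
   Context: ``Random variables'' here are virtual: for each $L$ a (complex) linear functional $\mathbb E$ on polynomials in the symbols $\xi_1(L),\dots,\xi_q(L)$ with $\mathbb E1=1$ is given, its values on monomials being the joint ``moments''; they need not come from a probability measure. Convergence in the sense of moments to a Gaussian vector means that all joint moments of the normalized centered variables converge to the values given by Wick's (Isserlis') formula: odd moments tend to $0$, and $\mathbb E(\zeta_{k_1}\cdots\zeta_{k_{n}})=\sum_{\text{perfect matchings}}\prod\mathbb E(\zeta_{k_i}\zeta_{k_j})$ for even $n$. A multicontour is a finite ordered collection of closed positively oriented contours in $\mathbb C$; its dimension is the number of contours in it. Fix an integer $q>0$. The following data are given. (1) For each $k=1,\dots,q$, an integer $l(k)>0$. (2) For any $n\ge1$ and any $n$-tuple of integers $K=(1\le k_1\le k_2\le\dots\le k_n\le q)$, a nonempty class $\aleph_K$ whose elements $\boldsymbol\gamma=(\gamma_1,\dots,\gamma_n)$ are families of $n$ multicontours, $\gamma_i$ being $l(k_i)$-dimensional. (3) If $\boldsymbol\gamma=(\gamma_1,\dots,\gamma_n)\in\aleph_K$ and $1\le i_1<\dots<i_t\le n$, then $(\gamma_{i_1},\dots,\gamma_{i_t})\in\aleph_{K'}$ with $K'=(k_{i_1}\le\dots\le k_{i_t})$. (4) For each $k=1,\dots,q$ and each $L$, a continuous function $\mathfrak F^k_L(u_1,\dots,u_{l(k)})$. If $\boldsymbol\gamma\in\aleph_K$, $1\le i\le n$ and $k=k_i$, then $\mathfrak F^k_L$ converges as $L\to\infty$ to a continuous function $\mathfrak F^k$ uniformly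 over $(u_1,\dots,u_{l(k)})\in\gamma_i$. (5) For each pair $1\le k,r\le q$ and each $L$, a continuous function $\mathfrak{Cr}^{k,r}_L(u_1,\dots,u_{l(k)};v_1,\dots,v_{l(r)})$. If $\boldsymbol\gamma\in\aleph_K$, $1\le i<j\le n$, $a=k_i$, $b=k_j$, then $\mathfrak{Cr}^{a,b}_L$ converges as $L\to\infty$ to a continuous function $\mathfrak{Cr}^{a,b}$ uniformly over $(u_1,\dots,u_{l(a)})\in\gamma_i$, $(v_1,\dots,v_{l(b)})\in\gamma_j$. (6) For each $k=1,\dots,q$, ($L$-dependent) nonzero constants $c_L(k)$. (7) A fixed real parameter $\gamma>0$. **Moment formula.** For any $n\ge1$ and any $K=(1\le k_1\le\dots\le k_n\le q)$ there exists $L(K)>0$ such that for $L>L(K)$ $$\mathbb E(\xi_{k_1}(L)\cdots\xi_{k_n}(L))=\prod_{i=1}^nc_L(k_i)\oint\cdots\oint\prod_{1\le i<j\le n}Cr_L(k_i,i;k_j,j)\prod_{i=1}^nF_L(k_i,i),$$ where $F_L(k,i)=\mathfrak F^k_L(u^i_1,\dots,u^i_{l(k)})\,du^i_1\cdots du^i_{l(k)}$ and $Cr_L(k,i;r,j)=1+L^{-\gamma}\,\mathfrak{Cr}^{k,r}_L(u^i_1,\dots,u^i_{l(k)};u^j_1,\dots,u^j_{l(r)})$, and the integration goes over $(u^i_1,\dots,u^i_{l(k_i)})\in\gamma_i$, $i=1,\dots,n$, for any $\boldsymbol\gamma=(\gamma_1,\dots,\gamma_n)\in\aleph_K$ (the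 value being the same for all such $\boldsymbol\gamma$). *)

(* Defs.v *)
From HB Require Import structures.
From mathcomp Require Import all_boot all_order all_algebra.
From mathcomp Require Import all_classical all_reals all_analysis.
From mathcomp Require Import complex.
(* The notations of mpoly clash with those of mathcomp-analysis; its canonical
   structures are needed. *)
From mathcomp Require Import -(notations) mpoly.

Set Implicit Arguments.
Unset Strict Implicit.
Unset Printing Implicit Defensive.

Import Order.TTheory GRing.Theory Num.Theory.
Import numFieldNormedType.Exports.

Local Open Scope classical_set_scope.
Local Open Scope ring_scope.
Local Open Scope complex_scope.

(* R[i] with the topology of its modulus, i.e. the topology which
   mathcomp-analysis puts on every numFieldType. *)
HB.instance Definition _ (R : realType) := NormedModule.copy R[i] R[i]^o.

Section Contours.
Variable R : realType.
Implicit Types (f : R[i] -> R[i]) (z : R[i]).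

Definition C1 (g : R -> R) : Prop :=
  (forall t, derivable g t 1) /\ continuous (derive1 g).

(* Only the restriction of the parametrization to [0, 1] matters; every C^1
   function on [0, 1] is the restriction of a C^1 function on the line. *)
Record arc := Arc {
  arc_x : R -> R;
  arc_y : R -> R;
  arc_xC1 : C1 arc_x;
  arc_yC1 : C1 arc_y }.

Definition arc_pt (a : arc) (t : R) : R[i] := arc_x a t +i* arc_y a t.

Definition arc_velocity (a : arc) (t : R) : R[i] :=
  derive1 (arc_x a) t +i* derive1 (arc_y a) t.

Definition cintegral01 (h : R -> R[i]) : R[i] :=
  (\int[lebesgue_measure]_(t in `[0%R, 1%R]) complex.Re (h t)) +i*
  (\int[lebesgue_measure]_(t in `[0%R, 1%R]) complex.Im (h t)).

Definition arc_integral (a : arc) f : R[i] :=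
  cintegral01 (fun t => f (arc_pt a t) * arc_velocity a t).

(* Closed piecewise C^1 curves; ordS is the cyclic successor. *)
Record closed_curve := ClosedCurve {
  curve_size : nat;
  curve_arc : 'I_curve_size -> arc;
  curve_closed : forall i, arc_pt (curve_arc i) 1 = arc_pt (curve_arc (ordS i)) 0 }.

Definition trace (c : closed_curve) : set R[i] :=
  [set z | exists (i : 'I_(curve_size c)) (t : R), `[0%R, 1%R]%classic t /\ z = arc_pt (curve_arc i) t].

Definition curve_integral (c : closed_curve) f : R[i] :=
  \sum_(i < curve_size c) arc_integral (curve_arc i) f.

Definition winding (c : closed_curve) z : R[i] :=
  (2 * pi%:C * 'i)^-1 * curve_integral c (fun w => (w - z)^-1).

(* For a Jordan curve this says exactly that it is traversed
   counterclockwise. *)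
Definition positively_oriented (c : closed_curve) : Prop :=
  (forall z, ~ trace c z -> winding c z = 0 \/ winding c z = 1) /\
  (exists z, ~ trace c z /\ winding c z = 1).

Record contour := Contour {
  contour_curve :> closed_curve;
  contour_positive : positively_oriented contour_curve }.

Definition multicontour (d : nat) := 'I_d -> contour.

Definition mtrace d (g : multicontour d) : set 'rV[R[i]]_d :=
  [set u | forall m, trace (g m) (u ord0 m)].

(* Iterated contour integral of f over the variables listed in s, the head of s
   being the outermost one; the other variables keep the values given by v. *)
Fixpoint iterated_integral (T : eqType) (c : T -> contour)
    (f : (T -> R[i]) -> R[i]) (s : seq T) (v : T -> R[i]) : R[i] :=
  if s is t :: s' then
    curve_integral (c t) (fun z =>
      iterated_integral c f s' (fun t' => if t' == t then z else v t'))
  else f v.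

(* The integral over (u^1, ..., u^n) in g_1 x ... x g_n. The variable u^i_m is
   indexed by the dependent pair (i, m); as all variables are integrated out,
   their initial value 0 is irrelevant. *)
Definition family_integral n (d : 'I_n -> nat)
    (g : forall i, multicontour (d i))
    (f : (forall i, 'rV[R[i]]_(d i)) -> R[i]) : R[i] :=
  @iterated_integral {i : 'I_n & 'I_(d i)}
    (fun p => g (tag p) (tagged p))
    (fun v => f (fun i => \row_m v (existT (fun i => 'I_(d i)) i m)))
    (enum {: {i : 'I_n & 'I_(d i)}}) (fun=> 0).

End Contours.

(* The tuple (k, r). *)
Definition pair_idx (q : nat) (k r : 'I_q) : 'I_2 -> 'I_q :=
  fun i => if (i : nat) is 0 then k else r.

Definition nondecreasing_idx n q (K : 'I_n -> 'I_q) : Prop :=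
  {homo K : i j / (i <= j)%N}.

Section Moments.
Variables (R : realType) (q : nat).

Definition xi (k : 'I_q) : mpoly q R[i] := mpolyX R[i] (mnm1 k).

(* (xi_k - E xi_k) / a *)
Definition normalized (E : {scalar mpoly q R[i]}) (a : R[i]) (k : 'I_q) :
    mpoly q R[i] :=
  a^-1 *: (xi k - mpolyC q (E (xi k))).

Definition perfect_matching n (P : {set {set 'I_n}}) : bool :=
  finset.partition P [set: 'I_n]%SET && [forall B in P, #|B| == 2].

(* Wick's formula for E(zeta_(K 1) ... zeta_(K n)), where Sigma k r stands for
   E(zeta_k zeta_r). It gives 0 for odd n, as there is no perfect matching. *)
Definition gaussian_moment (Sigma : 'M[R[i]]_q) n (K : 'I_n -> 'I_q) : R[i] :=
  \sum_(P : {set {set 'I_n}} | perfect_matching P)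
    \prod_(e : 'I_n * 'I_n | (e.1 < e.2)%N && ([set e.1; e.2]%SET \in P))
      Sigma (K e.1) (K e.2).

(* Convergence, as L -> +oo, of the vector Z L 1, ..., Z L q of virtual random
   variables to the Gaussian vector with mean 0 and covariance Sigma. *)
Definition cvg_gaussian_moments (E : R -> {scalar mpoly q R[i]})
    (Z : R -> 'I_q -> mpoly q R[i]) (Sigma : 'M[R[i]]_q) : Prop :=
  forall n (K : 'I_n -> 'I_q),
    E L (\prod_(i < n) Z L (K i)) @[L --> +oo] --> gaussian_moment Sigma K.

End Moments.

Section MomentFormula.
Variables (R : realType) (q : nat) (l : 'I_q -> nat).
Variable F : forall k : 'I_q, 'rV[R[i]]_(l k) -> R[i].
Variable Cr : forall k r : 'I_q, 'rV[R[i]]_(l k) * 'rV[R[i]]_(l r) -> R[i].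

(* h stands for L^(-gamma). *)
Definition moment_integrand (h : R) n (K : 'I_n -> 'I_q)
    (u : forall i, 'rV[R[i]]_(l (K i))) : R[i] :=
  (\prod_(i < n) \prod_(j < n | (i < j)%N) (1 + h%:C * Cr (u i, u j))) *
  \prod_(i < n) F (u i).

Definition covariance_integrand (k r : 'I_q)
    (u : forall i, 'rV[R[i]]_(l (pair_idx k r i))) : R[i] :=
  let u1 : 'rV_(l k) := u ord0 in
  let u2 : 'rV_(l r) := u ord_max in
  Cr (u1, u2) * F u1 * F u2.

End MomentFormula.

(* Main.v *)
(* Write h = L^(-gamma) = a^2. For a nondecreasing index K and a family of contours
   in aleph_K, expand the product of the centered variables over the set S of the
   indices where xi itself (not its mean) is taken. All terms become integrals over
   the same full family of contours, since integrals of functions of disjoint groups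
   of variables multiply. Expanding prod (1 + h Cr) over graphs with vertices in S
   and summing over S with signs, only the graphs G without isolated vertices
   survive, with weight h^|G|. The normalization a^(-n) turns it into a^(2|G| - n),
   where 2|G| >= n with equality exactly for perfect matchings; as the integrands
   converge uniformly, only the matchings remain in the limit, and their integrals
   factor into covariances. A general index is sorted by a permutation. *)
Require Import Defs.
From HB Require Import structures.
From mathcomp Require Import all_boot all_order all_algebra.
From mathcomp Require Import all_classical all_reals all_analysis.
From mathcomp Require Import complex.
From mathcomp Require Import -(notations) mpoly.
From mathcomp Require Import perm ring lra.
Import Order.TTheory GRing.Theory Num.Theory.
Import numFieldNormedType.Exports.
Local Open Scope classical_set_scope.
Local Open Scope ring_scope.
Local Open Scope complex_scope.

Set Implicit Arguments.
Unset Strict Implicit.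
Unset Printing Implicit Defensive.

(** * Uniform continuity for complex functions *)

(** The factor a^(-n) leaves no room for asymptotic cancellation: single terms of the centered
    product are in general of order 1, so they must cancel exactly, before any limit. This is why
    one family in [aleph n K] is fixed: by assumption (3) its subfamilies serve for all sub-moments.
    A graph G then occurs in the term of every S containing its vertices, with the sign given by the
    complement of S, and these signs sum to a product of factors 1 - 1 over the isolated vertices.
    The integrands are known to be continuous only on the contours. Hence all estimates are relative
    to the torus of assignments that put each variable on its contour, and every integral over a
    group of variables keeps the order of integration of the full family; a factorization only pulls
    constants out of one-variable integrals. Different edges of a matching select different pairs of
    contours; their integrals are identified because each is the limit of the same second
    moments. *)

Section L1Norm.
Variable R : realType.
Implicit Types z w : R[i].

(* The norm of [R[i]] takes its values in [R[i]]; the l1 norm keeps all estimates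
   in [R]. *)
Definition nl z : R := `|complex.Re z| + `|complex.Im z|.

Lemma nl_ge0 z : 0 <= nl z.
Proof. by rewrite addr_ge0. Qed.

Lemma nl0 : nl 0 = 0.
Proof. by rewrite /nl /= normr0 addr0. Qed.

Lemma nlN z : nl (- z) = nl z.
Proof. by case: z => a b; rewrite /nl /= !normrN. Qed.

Lemma nl_distC z w : nl (z - w) = nl (w - z).
Proof. by rewrite -nlN opprB. Qed.

Lemma ler_nlD z w : nl (z + w) <= nl z + nl w.
Proof.
case: z w => [a b] [c d]; rewrite /nl /= addrACA.
by rewrite lerD// ler_normD.
Qed.

Lemma ler_nl_dist u z w : nl (z - w) <= nl (z - u) + nl (u - w).
Proof. by rewrite -[X in nl X](_ : (z - u) + (u - w) = _) ?ler_nlD// addrA subrK. Qed.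

Lemma ler_nlM z w : nl (z * w) <= nl z * nl w.
Proof.
case: z w => [a b] [c d]; rewrite /nl /=.
have := ler_normB (a * c) (b * d); have := ler_normD (a * d) (b * c).
by rewrite !normrM; lra.
Qed.

Lemma ler_Re_nl z : `|complex.Re z| <= nl z.
Proof. by rewrite lerDl. Qed.

Lemma ler_Im_nl z : `|complex.Im z| <= nl z.
Proof. by rewrite lerDr. Qed.

Lemma nl_real (x : R) : nl x%:C = `|x|.
Proof. by rewrite /nl /= normr0 addr0. Qed.

Lemma normc_le_nl z : `|z| <= (nl z)%:C.
Proof.
rewrite normc_def lecR; case: z => a b; rewrite /nl /=.
rewrite -[leRHS]ger0_norm ?addr_ge0// -sqrtr_sqr ler_sqrt ?sqr_ge0//.
rewrite sqrrD !real_normK ?num_real//.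
have : 0 <= `|a| * `|b| by rewrite mulr_ge0.
by lra.
Qed.

Lemma nl_le_normc z : (nl z)%:C <= 2%:R * `|z|.
Proof.
have -> : (2%:R : R[i]) = (2%:R : R)%:C by rewrite rmorph_nat.
rewrite normc_def -rmorphM lecR /= mulr_natl mulr2n /nl; case: z => a b /=.
rewrite lerD// -sqrtr_sqr ler_sqrt ?addr_ge0 ?sqr_ge0//.
  by rewrite lerDl sqr_ge0.
by rewrite lerDr sqr_ge0.
Qed.

(** The order of [R[i]] only compares numbers with equal imaginary parts, so a positive radius is
    real. This turns the radii of the topology, which live in [R[i]], into real ones. *)
Lemma gt0_complexE (e : R[i]) : 0 < e -> e = (complex.Re e)%:C /\ 0 < complex.Re e.
Proof. by case: e => a b; rewrite ltcE /= => /andP[/eqP-> a0]. Qed.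

Lemma nl_ball z w (e : R) : nl (z - w) < e -> ball z e%:C w.
Proof.
move=> h; rewrite -ball_normE /ball_ /=.
by apply: le_lt_trans (normc_le_nl _) _; rewrite ltcR.
Qed.

Lemma ball_nl z w (e : R) : ball z e%:C w -> nl (z - w) < 2%:R * e.
Proof.
rewrite -ball_normE /ball_ /= => h.
rewrite -ltcR; apply: le_lt_trans (nl_le_normc _) _.
by rewrite rmorphM /= rmorph_nat ltr_pM2l ?ltr0n.
Qed.

Lemma cvg_nlP {T : Type} {G : set_system T} {FG : Filter G} (f : T -> R[i]) z :
  f @ G --> z <-> (forall e : R, 0 < e -> \forall t \near G, nl (z - f t) < e).
Proof.
split=> [/cvgrPdist_lt h e e0|h].
  have e20 : 0 < (e / 2%:R)%:C :> R[i] by rewrite ltcR divr_gt0.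
  apply: filterS (h _ e20) => t /= ht.
  have := @ball_nl z (f t) (e / 2%:R); rewrite -ball_normE => /(_ ht).
  by rewrite mulrC divfK// pnatr_eq0.
apply/cvgrPdist_lt => e /gt0_complexE[-> e0].
apply: filterS (h _ e0) => t /= ht.
by have := nl_ball ht; rewrite -ball_normE.
Qed.

Lemma uniform_nl {U : choiceType} (A : set U) {G : set_system R} {FG : Filter G}
    (f : R -> U -> R[i]) (g : U -> R[i]) :
  {uniform A, f t @[t --> G] --> g} ->
  forall e : R, 0 < e -> \forall t \near G, forall u, A u -> nl (g u - f t u) < e.
Proof.
move=> h e e0.
pose E := [set xy : R[i] * R[i] | ball xy.1 ((e / 2%:R)%:C) xy.2].
have hE : entourage E by rewrite -entourage_ballE; exists (e / 2%:R)%:C; rewrite //= ltcR divr_gt0.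
have : nbhs (g : {uniform` A -> R[i]}) [set k | forall y, A y -> E (g y, k y)].
  by apply: (iffRL (uniform_nbhs (g : {uniform` A -> R[i]}) _)); exists E; split=> // k.
move=> /h H; have {H} : \forall t \near G, forall y, A y -> E (g y, f t y) by exact: H.
apply: filterS => t /= ht u Au.
by have := ball_nl (ht u Au); rewrite /= mulrC divfK// pnatr_eq0.
Qed.

End L1Norm.

Section UniformContinuity.
Variable R : realType.
Variables (U : pseudoMetricType R[i]) (A : set U) (f : U -> R[i]).
Hypotheses (cA : compact A) (cf : {within A, continuous f}).

Let within_nl x (e : R) : A x -> 0 < e ->
  \forall y \near x, A y -> nl (f x - f y) < e.
Proof.
move=> Ax e0.
by have /cvg_nlP/(_ _ e0) := iffLR (subspace_continuousP _ _) cf x Ax.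
Qed.

(** Compactness enters as a near-covering property whose parameter is the bound [M] tending to +oo:
    near each point every large [M] works, hence one [M] works everywhere. *)
Lemma compact_bounded_nl : exists M : R, forall x, A x -> nl (f x) <= M.
Proof.
have := cA; rewrite compact_near_coveringP => /near_covering_withinP.
move=> /(_ R (pinfty_nbhs R) (fun M x => nl (f x) <= M) _) H.
have : \forall M \near +oo, A `<=` (fun x => nl (f x) <= M).
  apply: H => x Ax; have := within_nl Ax ltr01 => {}H.
  exists ([set y | A y -> nl (f x - f y) < 1], [set M | nl (f x) + 1 <= M]) => /=.
    by split=> //; apply: nbhs_pinfty_ge; rewrite num_real.
  move=> [y M] /= [h1 h2] Ay; apply: le_trans h2.
  rewrite -[X in nl X <= _](subrK (f x)) addrC (le_trans (ler_nlD _ _))//.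
  by rewrite lerD2l nl_distC ltW// h1.
by move=> [M [_ /(_ (M + 1))]]; rewrite ltrDl ltr01 => /(_ isT) ?; exists (M + 1).
Qed.

(** The same covering argument with the radius [d] tending to 0 from the right. Only half of the
    radius of continuity at a point is given to the covering, so that [y] still falls within the
    full radius. *)
Lemma compact_unif_continuous_nl (e : R) : 0 < e ->
  exists2 d : R, 0 < d &
    forall x y, A x -> A y -> ball x d%:C y -> nl (f x - f y) < e.
Proof.
move=> e0.
have := cA; rewrite compact_near_coveringP => /near_covering_withinP.
move=> /(_ R 0^'+ (fun d x => forall y, A y -> ball x d%:C y -> nl (f x - f y) < e) _) H.
have : \forall d \near 0^'+,
    A `<=` (fun x => forall y, A y -> ball x d%:C y -> nl (f x - f y) < e).
  apply: H => x Ax.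
  have e20 : 0 < e / 2%:R by rewrite divr_gt0.
  have /nbhs_ballP[r /= /gt0_complexE[-> r0] hr] := within_nl Ax e20.
  set r' := complex.Re r in hr r0.
  exists (ball x (r' / 2%:R)%:C, [set d | 0 < d < r' / 2%:R]) => /=.
    split; first by apply: nbhsx_ballx; rewrite ltcR divr_gt0.
    near=> d; apply/andP; split; near: d; first exact: nbhs_right_gt.
    by apply: nbhs_right_lt; rewrite divr_gt0.
  move=> [x' d] /= [xx' /andP[d0 dr]] Ax' y Ay x'y.
  rewrite (le_lt_trans (ler_nl_dist (f x) _ _))// [e]splitr ltrD//.
    rewrite nl_distC; apply: hr => //; apply: le_ball xx'.
    by rewrite lecR ler_pdivrMr// ler_peMr ?ler1n// ltW.
  apply: hr => //; rewrite [r']splitr rmorphD.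
  apply: ball_triangle xx' _; apply: le_ball x'y.
  by rewrite lecR ltW.
move=> [d /= d0 hd]; exists (d / 2%:R); first by rewrite divr_gt0.
move=> x y Ax; apply: (hd (d / 2%:R)) => //=; last by rewrite divr_gt0.
rewrite sub0r normrN gtr0_norm ?divr_gt0// ltr_pdivrMr// ltr_pMr// ltr1n//.
Unshelve. all: by end_near.
Qed.

End UniformContinuity.

(** * Contour integrals *)

Section CurveIntegral.
Variable R : realType.
Implicit Types (phi psi : R[i] -> R[i]) (a : Defs.arc R) (c : closed_curve R).

Local Notation I01 := (`[0%R, 1%R]%classic : set R).
Local Notation mu := (@lebesgue_measure R).

Definition unif_cont (A : set R[i]) phi : Prop :=
  forall e : R, 0 < e -> exists2 d : R, 0 < d &
    forall z w, A z -> A w -> nl (z - w) < d -> nl (phi z - phi w) < e.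

Lemma unif_contD A phi psi : unif_cont A phi -> unif_cont A psi ->
  unif_cont A (fun z => phi z + psi z).
Proof.
move=> u1 u2 e e0; have e20 : 0 < e / 2%:R by rewrite divr_gt0.
have [d d0 hd] := u1 _ e20; have [d' d'0 hd'] := u2 _ e20.
exists (Num.min d d'); first by rewrite lt_min d0.
move=> z w Az Aw; rewrite lt_min => /andP[h1 h2].
rewrite opprD addrACA (le_lt_trans (ler_nlD _ _))//.
by rewrite [e]splitr ltrD ?hd ?hd'.
Qed.

Lemma unif_contZ A (k : R[i]) phi : unif_cont A phi -> unif_cont A (fun z => k * phi z).
Proof.
move=> u e e0; have k0 : 0 < nl k + 1 by rewrite ltr_wpDl ?nl_ge0.
have [d d0 hd] := u (e / (nl k + 1)) (divr_gt0 e0 k0).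
exists d => // z w Az Aw zw; rewrite -mulrBr (le_lt_trans (ler_nlM _ _))//.
rewrite (@le_lt_trans _ _ ((nl k) * (e / (nl k + 1))))//.
  by rewrite ler_wpM2l ?nl_ge0// ltW// hd.
by rewrite mulrA ltr_pdivrMr// [ltRHS]mulrC ltr_pM2r// ltrDl.
Qed.

Definition cintegrable (h : R -> R[i]) : Prop :=
  mu.-integrable I01 (EFin \o (fun t => complex.Re (h t))) /\
  mu.-integrable I01 (EFin \o (fun t => complex.Im (h t))).

Lemma cintegral01D h1 h2 : cintegrable h1 -> cintegrable h2 ->
  cintegral01 (fun t => h1 t + h2 t) = cintegral01 h1 + cintegral01 h2.
Proof.
move=> [r1 i1] [r2 i2]; rewrite /cintegral01.
under eq_Rintegral do rewrite raddfD.
under [X in _ +i* X]eq_Rintegral do rewrite raddfD.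
by rewrite !RintegralD.
Qed.

Lemma cintegral01Z (k : R[i]) h : cintegrable h ->
  cintegral01 (fun t => k * h t) = k * cintegral01 h.
Proof.
move=> [r1 i1]; rewrite /cintegral01; case: k => a b.
have ReE t : complex.Re ((a +i* b) * h t) = a * complex.Re (h t) + (- b) * complex.Im (h t).
  by case: (h t) => x y /=; rewrite mulNr.
have ImE t : complex.Im ((a +i* b) * h t) = a * complex.Im (h t) + b * complex.Re (h t).
  by case: (h t).
under eq_Rintegral do rewrite ReE.
under [X in _ +i* X]eq_Rintegral do rewrite ImE.
have iZ (x : R) (g : R -> R) : mu.-integrable I01 (EFin \o g) ->
    mu.-integrable I01 (EFin \o (fun t => x * g t)).
  move=> ig; have -> : EFin \o (fun t => x * g t) = (fun t => x%:E * (EFin \o g) t)%E.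
    by apply/funext => t /=; rewrite EFinM.
  exact: integrableZl.
rewrite !RintegralD ?RintegralZl//; try exact: iZ.
by rewrite mulNr.
Qed.

(** The factor 2 comes from bounding the real and the imaginary part separately; the value of the
    constant is immaterial for limits. *)
Lemma cintegral01_le h (M : R) : cintegrable h ->
  (forall t, I01 t -> nl (h t) <= M) -> nl (cintegral01 h) <= 2%:R * M.
Proof.
move=> [r1 i1] hM.
have bnd (g : R -> R) : mu.-integrable I01 (EFin \o g) ->
    (forall t, I01 t -> `|g t| <= M) ->
    `|\int[mu]_(t in I01) g t| <= M.
  move=> ig gM; apply: le_trans (le_normr_Rintegral _ ig) _ => //.
  have -> : M = \int[mu]_(t in I01) M.
    rewrite Rintegral_cst// [X in fine X](_ : _ = 1%E) ?mulr1//.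
    by apply: etrans (lebesgue_measure_itv _) _; rewrite /= lte_fin ltr01 oppr0 adde0.
  apply: le_Rintegral => //.
    by have := integrable_norm ig.
  apply: continuous_compact_integrable; first exact: segment_compact.
  by apply: continuous_subspaceT => t; exact: cvg_cst.
rewrite mulr_natl mulr2n /nl /= lerD// bnd// => t It; apply: le_trans (hM _ It).
  exact: ler_Re_nl.
exact: ler_Im_nl.
Qed.

Lemma arc_pt_cvg a t (e : R) : 0 < e ->
  \forall s \near t, nl (arc_pt a t - arc_pt a s) < e.
Proof.
move=> e0.
have e20 : 0 < e / 2%:R by rewrite divr_gt0.
have cont (g : R -> R) : C1 g -> \forall s \near t, `|g t - g s| < e / 2%:R.
  move=> [dg _]; have /differentiable_continuous cg : differentiable g t by exact/derivable1_diffP.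
  by have /cvgrPdist_lt/(_ _ e20) := cg.
have := cont _ (arc_xC1 a); apply: filterS2 (cont _ (arc_yC1 a)) => s hy hx.
by rewrite /nl /= [e]splitr ltrD.
Qed.

(** As [phi] is controlled on [A] only, continuity is relative to [0, 1]; on this compact interval
    it gives integrability. *)
Lemma arc_cintegrable a phi (A : set R[i]) :
  (forall t, I01 t -> A (arc_pt a t)) -> unif_cont A phi ->
  cintegrable (fun t => phi (arc_pt a t) * arc_velocity a t).
Proof.
move=> aA uc.
have cw : forall f : R[i] -> R, (forall z w, `|f z - f w| <= nl (z - w)) ->
    {within I01, continuous (fun t => f (phi (arc_pt a t)))}.
  move=> f hf; apply/subspace_continuousP => t It.
  apply/cvgrPdist_lt => e e0.
  have [d d0 hd] := uc _ e0.
  have := arc_pt_cvg a t d0; rewrite !near_withinE; apply: filterS => s hs Is.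
  by apply: le_lt_trans (hf _ _) _; apply: hd => //; exact: aA.

have cR : {within I01, continuous (fun t => complex.Re (phi (arc_pt a t)))}.
  by apply: cw => z w; rewrite -raddfB ler_Re_nl.
have cI : {within I01, continuous (fun t => complex.Im (phi (arc_pt a t)))}.
  by apply: cw => z w; rewrite -raddfB ler_Im_nl.
have cx : {within I01, continuous (derive1 (arc_x a))}.
  by apply: continuous_subspaceT; have [] := arc_xC1 a.
have cy : {within I01, continuous (derive1 (arc_y a))}.
  by apply: continuous_subspaceT; have [] := arc_yC1 a.
split; apply: continuous_compact_integrable; try exact: segment_compact.
  have -> : (fun t => complex.Re (phi (arc_pt a t) * arc_velocity a t)) =
      (fun t => complex.Re (phi (arc_pt a t)) * derive1 (arc_x a) t -
        complex.Im (phi (arc_pt a t)) * derive1 (arc_y a) t).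
    by apply/funext => t; rewrite /arc_velocity; case: (phi _).
  move=> t; apply: cvgB; apply: cvgM.
  - exact: cR.
  - exact: cx.
  - exact: cI.
  - exact: cy.
have -> : (fun t => complex.Im (phi (arc_pt a t) * arc_velocity a t)) =
    (fun t => complex.Re (phi (arc_pt a t)) * derive1 (arc_y a) t +
      complex.Im (phi (arc_pt a t)) * derive1 (arc_x a) t).
  by apply/funext => t; rewrite /arc_velocity; case: (phi _).
move=> t; apply: cvgD; apply: cvgM.
- exact: cR.
- exact: cy.
- exact: cI.
- exact: cx.
Qed.

Lemma arc_velocity_bounded a : exists2 V : R, 0 <= V &
  forall t, I01 t -> nl (arc_velocity a t) <= V.
Proof.
have cx : {within I01, continuous (derive1 (arc_x a))}.
  by apply: continuous_subspaceT; have [] := arc_xC1 a.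
have cy : {within I01, continuous (derive1 (arc_y a))}.
  by apply: continuous_subspaceT; have [] := arc_yC1 a.
have cv : {within I01, continuous (fun t => nl (arc_velocity a t))}.
  move=> t; rewrite /nl /=; apply: cvgD; apply: cvg_norm; [exact: cx|exact: cy].
have [t0 _ ht0] := EVT_max ler01 cv.
by exists (nl (arc_velocity a t0)) => [|t /ht0//]; exact: nl_ge0.
Qed.

Section FixedCurve.
Variable c : closed_curve R.

Let in_trace (i : 'I_(curve_size c)) t : I01 t -> trace c (arc_pt (curve_arc i) t).
Proof. by move=> It; exists i, t. Qed.

Lemma eq_curve_integral phi psi :
  (forall z, trace c z -> phi z = psi z) ->
  curve_integral c phi = curve_integral c psi.
Proof.
move=> h; apply: eq_bigr => i _; rewrite /arc_integral /cintegral01.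
by congr (_ +i* _); apply: eq_Rintegral => t /set_mem It; rewrite h//; exact: in_trace.
Qed.

Lemma curve_integralD phi psi : unif_cont (trace c) phi -> unif_cont (trace c) psi ->
  curve_integral c (fun z => phi z + psi z) = curve_integral c phi + curve_integral c psi.
Proof.
move=> u1 u2; rewrite /curve_integral -big_split; apply: eq_bigr => i _ /=.
rewrite /arc_integral -cintegral01D; last 2 first.
- by apply: (@arc_cintegrable _ _ (trace c)) => //; exact: in_trace.
- by apply: (@arc_cintegrable _ _ (trace c)) => //; exact: in_trace.
by congr cintegral01; apply/funext => t; rewrite mulrDl.
Qed.

Lemma curve_integralZ (k : R[i]) phi : unif_cont (trace c) phi ->
  curve_integral c (fun z => k * phi z) = k * curve_integral c phi.
Proof.
move=> u; rewrite /curve_integral big_distrr; apply: eq_bigr => i _ /=.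
rewrite /arc_integral -cintegral01Z; last first.
  by apply: (@arc_cintegrable _ _ (trace c)) => //; exact: in_trace.
by congr cintegral01; apply/funext => t; rewrite mulrA.
Qed.

(** [len] stands in for the length of the curve. It does not depend on [phi], so that small
    integrands have small integrals. *)
Lemma curve_integral_le : exists2 len : R, 0 <= len &
  forall phi M, unif_cont (trace c) phi ->
    (forall z, trace c z -> nl (phi z) <= M) ->
    nl (curve_integral c phi) <= len * M.
Proof.
have /choice[V hV] : forall i, exists V, 0 <= V /\
    forall t, I01 t -> nl (arc_velocity (@curve_arc R c i) t) <= V.
  by move=> i; have [V] := arc_velocity_bounded (@curve_arc R c i); exists V.
exists (\sum_i 2%:R * V i).
  by apply: sumr_ge0 => i _; rewrite mulr_ge0//; have [] := hV i.
move=> phi M uc hM; rewrite /curve_integral big_distrl /=.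
apply: (big_ind2 (fun x y => nl x <= y)); first by rewrite nl0.
  by move=> x1 x2 y1 y2 h1 h2; apply: le_trans (ler_nlD _ _) (lerD _ _).
move=> i _; rewrite -mulrA; apply: cintegral01_le.
  by apply: (@arc_cintegrable _ _ (trace c)) => //; exact: in_trace.
move=> t It; apply: le_trans (ler_nlM _ _) _; rewrite mulrC.
have [V0 hVi] := hV i.
apply: ler_pM; rewrite ?nl_ge0 ?hVi//.
by apply: hM; exact: in_trace.
Qed.

Lemma compact_trace : compact (trace c : set R[i]).
Proof.
have -> : trace c =
    \big[setU/set0]_(i <- enum 'I_(curve_size c)) (arc_pt (curve_arc i) @` I01).
  rewrite -bigcup_seq; apply/seteqP; split => [z [i [t [It ->]]]|z [i _ [t It <-]]].
    by exists i => /=; [rewrite mem_enum|exists t].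
  by exists i, t.
apply: bigsetU_compact => i _; apply: continuous_compact; last exact: segment_compact.
by apply: continuous_subspaceT => t; apply/cvg_nlP => e; exact: arc_pt_cvg.
Qed.

End FixedCurve.

(** A curve without arcs has all its winding numbers 0, while a positively oriented one takes the
    value 1. This provides base points on the contours. *)
Lemma contour_trace_neq0 (c : contour R) : exists z, trace c z.
Proof.
have [_ [z [_]]] := contour_positive c; rewrite /winding /curve_integral.
case: c => [[[|n] ar cl] pos] /=.
  by rewrite big_ord0 mulr0 => /eqP; rewrite eq_sym oner_eq0.
move=> _; exists (arc_pt (ar ord0) 0), ord0, 0; split=> //.
by rewrite /= in_itv/= lexx ler01.
Qed.

End CurveIntegral.

(** * Iterated integrals and uniform limits *)

Section IteratedIntegral.
Variables (R : realType) (T : finType) (c : T -> contour R).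
Implicit Types (f g : (T -> R[i]) -> R[i]) (v w : T -> R[i]) (s : seq T).

Definition torus : set (T -> R[i]) := [set v | forall t, trace (c t) (v t)].

Definition upd v t z : T -> R[i] := fun t' => if t' == t then z else v t'.

Lemma torus_upd v t z : torus v -> trace (c t) z -> torus (upd v t z).
Proof. by move=> vT cz t'; rewrite /upd; case: eqP => [->|]. Qed.

Lemma torus_neq0 : exists v, torus v.
Proof. by have [v hv] := choice (fun t => contour_trace_neq0 (c t)); exists v. Qed.

(** Boundedness is carried along with uniform continuity to make the class stable under products.
    The class is also stable under integration in one variable, so every stage of an iterated
    integral is integrable and linearity applies there. *)
Definition nice f : Prop :=
  (exists2 M : R, 0 <= M & forall v, torus v -> nl (f v) <= M) /\
  (forall e : R, 0 < e -> exists2 d : R, 0 < d & forall v w, torus v -> torus w ->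
     (forall t, nl (v t - w t) < d) -> nl (f v - f w) < e).

Lemma nice_cst (k : R[i]) : nice (fun=> k).
Proof.
split; first by exists (nl k) => //; exact: nl_ge0.
by move=> e e0; exists 1 => // v w _ _ _; rewrite subrr nl0.
Qed.

Lemma niceD f g : nice f -> nice g -> nice (fun v => f v + g v).
Proof.
move=> [[M M0 fM] cf] [[N N0 gN] cg]; split.
  exists (M + N); first by rewrite addr_ge0.
  by move=> v vT; apply: le_trans (ler_nlD _ _) _; rewrite lerD ?fM ?gN.
move=> e e0; have e20 : 0 < e / 2%:R by rewrite divr_gt0.
have [d d0 hd] := cf _ e20; have [d' d'0 hd'] := cg _ e20.
exists (Num.min d d'); first by rewrite lt_min d0.
move=> v w vT wT h; rewrite opprD addrACA (le_lt_trans (ler_nlD _ _))//.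
rewrite [e]splitr ltrD ?hd ?hd'// => t; have := h t; rewrite lt_min => /andP[]//.
Qed.

Lemma niceM f g : nice f -> nice g -> nice (fun v => f v * g v).
Proof.
move=> [[M M0 fM] cf] [[N N0 gN] cg]; split.
  exists (M * N); first by rewrite mulr_ge0.
  by move=> v vT; apply: le_trans (ler_nlM _ _) _; rewrite ler_pM ?nl_ge0 ?fM ?gN.
move=> e e0.
have MN0 : 0 < M + N + 1 by rewrite ltr_wpDl ?addr_ge0.
have e20 : 0 < e / (M + N + 1) by rewrite divr_gt0.
have [d d0 hd] := cf _ e20; have [d' d'0 hd'] := cg _ e20.
exists (Num.min d d'); first by rewrite lt_min d0.
move=> v w vT wT h.
have {}hd : nl (f v - f w) < e / (M + N + 1).
  by apply: hd => // t; have := h t; rewrite lt_min => /andP[].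
have {}hd' : nl (g v - g w) < e / (M + N + 1).
  by apply: hd' => // t; have := h t; rewrite lt_min => /andP[].
have -> : f v * g v - f w * g w = f v * (g v - g w) + (f v - f w) * g w.
  by rewrite mulrBr mulrBl addrA subrK.
rewrite (le_lt_trans (ler_nlD _ _))//.
have h1 : nl (f v * (g v - g w)) <= M * (e / (M + N + 1)).
  by apply: le_trans (ler_nlM _ _) _; rewrite ler_pM ?nl_ge0 ?fM// ltW.
have h2 : nl ((f v - f w) * g w) <= (e / (M + N + 1)) * N.
  by apply: le_trans (ler_nlM _ _) _; rewrite ler_pM ?nl_ge0 ?gN// ltW.
have -> : e = (M + N + 1) * (e / (M + N + 1)) by rewrite mulrC divfK ?lt0r_neq0.
by move: e20 h1 h2; set k := e / _; lra.
Qed.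

Lemma nice_sum (I : Type) (r : seq I) (P : pred I) (f : I -> (T -> R[i]) -> R[i]) :
  (forall i, P i -> nice (f i)) -> nice (fun v => \sum_(i <- r | P i) f i v).
Proof.
move=> fP; elim: r => [|i r IH].
  rewrite [X in nice X](_ : _ = fun=> 0); first exact: nice_cst.
  by apply/funext => v; rewrite big_nil.
case Pi : (P i).
  rewrite [X in nice X](_ : _ = fun v => f i v + \sum_(i <- r | P i) f i v).
    by apply: niceD => //; exact: fP.
  by apply/funext => v; rewrite big_cons Pi.
rewrite [X in nice X](_ : _ = fun v => \sum_(i <- r | P i) f i v)//.
by apply/funext => v; rewrite big_cons Pi.
Qed.

Lemma nice_prod (I : Type) (r : seq I) (P : pred I) (f : I -> (T -> R[i]) -> R[i]) :
  (forall i, P i -> nice (f i)) -> nice (fun v => \prod_(i <- r | P i) f i v).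
Proof.
move=> fP; elim: r => [|i r IH].
  rewrite [X in nice X](_ : _ = fun=> 1); first exact: nice_cst.
  by apply/funext => v; rewrite big_nil.
case Pi : (P i).
  rewrite [X in nice X](_ : _ = fun v => f i v * \prod_(i <- r | P i) f i v).
    by apply: niceM => //; exact: fP.
  by apply/funext => v; rewrite big_cons Pi.
rewrite [X in nice X](_ : _ = fun v => \prod_(i <- r | P i) f i v)//.
by apply/funext => v; rewrite big_cons Pi.
Qed.

Lemma nice_section f v t : nice f -> torus v ->
  unif_cont (trace (c t)) (fun z => f (upd v t z)).
Proof.
move=> [_ cf] vT e e0; have [d d0 hd] := cf _ e0; exists d => // z w cz cw zw.
apply: hd; [exact: torus_upd|exact: torus_upd|move=> t'; rewrite /upd].
by case: eqP => // _; rewrite subrr nl0.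
Qed.

(** One modulus of continuity serves all values of the integrated variable, so the difference of two
    values is the integral of a uniformly small function. *)
Lemma nice_curve_integral f t : nice f ->
  nice (fun v => curve_integral (c t) (fun z => f (upd v t z))).
Proof.
move=> nf; have [[M M0 fM] cf] := nf; have [len len0 hlen] := curve_integral_le (c t).
split.
  exists (len * M) => [|v vT]; first by rewrite mulr_ge0.
  apply: hlen => [|z cz]; first exact: nice_section.
  by apply: fM; exact: torus_upd.
move=> e e0; have l10 : 0 < len + 1 by rewrite ltr_wpDl.
have e'0 : 0 < e / (len + 1) by rewrite divr_gt0.
have [d d0 hd] := cf _ e'0; exists d => // v w vT wT vw.
have -> : curve_integral (c t) (fun z => f (upd v t z)) -
    curve_integral (c t) (fun z => f (upd w t z)) =
    curve_integral (c t) (fun z => f (upd v t z) + -1 * f (upd w t z)).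
  by rewrite curve_integralD ?curve_integralZ ?mulN1r//;
    try apply: unif_contZ; exact: nice_section.
have : len * (e / (len + 1)) < e.
  by rewrite mulrA ltr_pdivrMr// [ltRHS]mulrC ltr_pM2r// ltrDl.
apply: le_lt_trans; apply: hlen => [|z cz].
  by apply: unif_contD; try apply: unif_contZ; exact: nice_section.
rewrite mulN1r; apply/ltW/hd; [exact: torus_upd|exact: torus_upd|move=> t'; rewrite /upd].
by case: eqP => // _; rewrite subrr nl0.
Qed.

Lemma nice_iterated_integral f s : nice f -> nice (iterated_integral c f s).
Proof. by move=> nf; elim: s => //= t s IH; exact: (nice_curve_integral t IH). Qed.

Lemma iterated_integralD f g s v : nice f -> nice g -> torus v ->
  iterated_integral c (fun v => f v + g v) s v =
  iterated_integral c f s v + iterated_integral c g s v.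
Proof.
move=> nf ng; elim: s v => //= t s IH v vT.
rewrite -curve_integralD; try by apply: (nice_section t _ vT); exact: nice_iterated_integral.
by apply: eq_curve_integral => z cz; apply: IH; exact: torus_upd.
Qed.

Lemma iterated_integralZ (k : R[i]) f s v : nice f -> torus v ->
  iterated_integral c (fun v => k * f v) s v = k * iterated_integral c f s v.
Proof.
move=> nf; elim: s v => //= t s IH v vT.
rewrite -curve_integralZ; last by apply: (nice_section t _ vT); exact: nice_iterated_integral.
by apply: eq_curve_integral => z cz; apply: IH; exact: torus_upd.
Qed.

Lemma iterated_integral0 s v : torus v -> iterated_integral c (fun=> 0) s v = 0.
Proof.
move=> vT; have := @iterated_integralZ 0 (fun=> 0) s v (nice_cst 0) vT.
by rewrite !mul0r.
Qed.

Lemma iterated_integral_sum (I : Type) (r : seq I) (P : pred I)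
    (f : I -> (T -> R[i]) -> R[i]) s v :
  (forall i, P i -> nice (f i)) -> torus v ->
  iterated_integral c (fun v => \sum_(i <- r | P i) f i v) s v =
  \sum_(i <- r | P i) iterated_integral c (f i) s v.
Proof.
move=> fP vT; elim: r => [|i r IH].
  rewrite big_nil -[RHS](iterated_integral0 s vT); congr iterated_integral.
  by apply/funext => w; rewrite big_nil.
rewrite big_cons -IH; case Pi : (P i).
  rewrite -iterated_integralD//; [|exact: fP|exact: nice_sum].
  by congr iterated_integral; apply/funext => w; rewrite big_cons Pi.
by congr iterated_integral; apply/funext => w; rewrite big_cons Pi.
Qed.

Lemma iterated_integral_le s : exists2 len : R, 0 <= len &
  forall f M v, nice f -> (forall v, torus v -> nl (f v) <= M) -> torus v ->
    nl (iterated_integral c f s v) <= len * M.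
Proof.
elim: s => [|t s [len len0 hlen]] /=.
  by exists 1 => // f M v _ fM vT; rewrite mul1r fM.
have [len' len'0 hlen'] := curve_integral_le (c t).
exists (len' * len) => [|f M v nf fM vT]; first exact: mulr_ge0.
rewrite -mulrA; apply: hlen' => [|z cz].
  by apply: (nice_section t _ vT); exact: nice_iterated_integral.
by apply: hlen => //; exact: torus_upd.
Qed.

Definition depends_on (A : pred T) f : Prop :=
  forall v w, (forall t, A t -> v t = w t) -> f v = f w.

(** An integrated variable is overwritten before the integrand is evaluated, so its initial value is
    lost. *)
Lemma depends_on_iterated_integral (A : pred T) f s : depends_on A f ->
  depends_on [pred t | A t & t \notin s] (iterated_integral c f s).
Proof.
move=> fA; elim: s => [|t s IH] v w vw /=.
  by apply: fA => t At; apply: vw; rewrite /= At.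
congr curve_integral; apply/funext => z; apply: IH => t' /andP[At' t's].
by case: eqP => // /eqP t't; apply: vw; rewrite /= At' inE negb_or t't.
Qed.

Lemma depends_on_sub (A B : pred T) f : {subset A <= B} -> depends_on A f -> depends_on B f.
Proof. by move=> AB fA v w vw; apply: fA => t At; apply: vw; exact: AB. Qed.

(* Variables of [f] and [g] may be interleaved in [s]: at each stage the factor
   which does not involve the current variable is a constant, so that Fubini's
   theorem is not needed. *)
Lemma iterated_integralM (A : pred T) f g s v :
  nice f -> nice g -> depends_on A f -> depends_on (predC A) g -> torus v ->
  iterated_integral c (fun v => f v * g v) s v =
  iterated_integral c f [seq t <- s | A t] v *
  iterated_integral c g [seq t <- s | ~~ A t] v.
Proof.
move=> nf ng fA gA; elim: s v => //= t s IH v vT.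
transitivity (curve_integral (c t) (fun z =>
    iterated_integral c f [seq t <- s | A t] (upd v t z) *
    iterated_integral c g [seq t <- s | ~~ A t] (upd v t z))).
  by apply: eq_curve_integral => z cz; apply: IH; exact: torus_upd.
case At : (A t) => /=.
  have gE z : iterated_integral c g [seq t <- s | ~~ A t] (upd v t z) =
              iterated_integral c g [seq t <- s | ~~ A t] v.
    apply: (depends_on_iterated_integral gA) => t' /andP[/= At' _].
    by rewrite /upd; case: eqP => // t't; move: At'; rewrite t't At.
  under eq_fun do rewrite gE mulrC.
  rewrite curve_integralZ 1?mulrC//.
  by apply: (nice_section t _ vT); exact: nice_iterated_integral.
have fE z : iterated_integral c f [seq t <- s | A t] (upd v t z) =
            iterated_integral c f [seq t <- s | A t] v.
  apply: (depends_on_iterated_integral fA) => t' /andP[/= At' _].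
  by rewrite /upd; case: eqP => // t't; move: At'; rewrite t't At.
under eq_fun do rewrite fE.
rewrite curve_integralZ//.
by apply: (nice_section t _ vT); exact: nice_iterated_integral.
Qed.

(** Induction from the two-factor case, splitting along [A i]. The list is filtered to variables
    belonging to some factor, since integrating over any other one would multiply the result by an
    integral of 1. *)
Lemma iterated_integral_prod (I : eqType) (r : seq I) (A : I -> pred T)
    (f : I -> (T -> R[i]) -> R[i]) s v :
  uniq r -> {in r, forall i, nice (f i)} -> (forall i, depends_on (A i) (f i)) ->
  {in r &, forall i j t, A i t -> A j t -> i = j} -> torus v ->
  iterated_integral c (fun v => \prod_(i <- r) f i v) [seq t <- s | has (A ^~ t) r] v =
  \prod_(i <- r) iterated_integral c (f i) [seq t <- s | A i t] v.
Proof.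
move=> + + fA + vT; elim: r => [_ _ _|i r IH /= /andP[ir ur] nf disj].
  by rewrite big_nil filter_pred0 /= big_nil.
rewrite big_cons -IH//; last 2 first.
- by move=> j jr; apply: nf; rewrite inE jr orbT.
- by move=> j k jr kr; apply: disj; rewrite inE ?jr ?kr orbT.
under eq_fun do rewrite big_cons.
have disj' j t : j \in r -> A i t -> A j t = false.
  move=> jr Ait; apply/negP => Ajt; move: ir.
  by rewrite (disj i j (mem_head _ _) _ t Ait Ajt) ?jr// inE jr orbT.
rewrite (iterated_integralM (A := A i))//; last 3 first.
- by apply: nf; exact: mem_head.
- under eq_fun do rewrite big_seq.
  by apply: nice_prod => j jr; apply: nf; rewrite inE jr orbT.
- move=> u w uw; apply: eq_big_seq => j jr; apply: fA => t Ajt.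
  by apply: uw => /=; apply/negP => Ait; rewrite (disj' j t jr Ait) in Ajt.
congr (_ * _); rewrite -filter_predI; congr iterated_integral.
  by apply: eq_filter => t /=; case: (A i t).
apply: eq_filter => t /=; case Ait : (A i t) => //=.
by apply/esym/hasP => -[j jr]; rewrite disj'.
Qed.

End IteratedIntegral.

(** * Passing to the limit under iterated integrals *)

Section Limits.
Variables (R : realType) (T : finType) (c : T -> contour R).

(** Uniform convergence on the torus alone is not stable under products; boundedness of the limit,
    contained in [nice], makes it so. Only [L > 0] is asked for, as in the continuity hypotheses. *)
Definition good (fL : R -> (T -> R[i]) -> R[i]) (f : (T -> R[i]) -> R[i]) : Prop :=
  [/\ forall L, 0 < L -> nice c (fL L), nice c f &
    forall e : R, 0 < e -> \forall L \near +oo, forall v, torus c v -> nl (f v - fL L v) < e].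

Lemma good_cst (a : R -> R[i]) b : a L @[L --> +oo] --> b ->
  good (fun L _ => a L) (fun=> b).
Proof.
move=> ab; split=> [L _||e e0]; [exact: nice_cst|exact: nice_cst|].
by have /cvg_nlP/(_ _ e0) := ab; apply: filterS => L h v _.
Qed.

Lemma goodD fL f gL g : good fL f -> good gL g ->
  good (fun L v => fL L v + gL L v) (fun v => f v + g v).
Proof.
move=> [nfL nf cf] [ngL ng cg]; split=> [L L0||e e0].
- by apply: niceD; [exact: nfL|exact: ngL].
- exact: niceD.
have e20 : 0 < e / 2%:R by rewrite divr_gt0.
apply: filterS2 (cf _ e20) (cg _ e20) => L h1 h2 v vT.
rewrite opprD addrACA (le_lt_trans (ler_nlD _ _))//.
by rewrite [e]splitr ltrD ?h1 ?h2.
Qed.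

Lemma goodM fL f gL g : good fL f -> good gL g ->
  good (fun L v => fL L v * gL L v) (fun v => f v * g v).
Proof.
move=> [nfL nf cf] [ngL ng cg]; split=> [L L0||e e0].
- by apply: niceM; [exact: nfL|exact: ngL].
- exact: niceM.
have [[M M0 fM] _] := nf; have [[N N0 gN] _] := ng.
have S0 : 0 < M + N + 1 + 1 by rewrite ltr_wpDl ?addr_ge0.
(* The cap 1 bounds [gL L v] by [N + 1], so the error is at most e' (M + N + 1); the second added 1
   makes the final inequality strict. *)
pose e' := Num.min 1 (e / (M + N + 1 + 1)).
have e'0 : 0 < e' by rewrite lt_min ltr01 divr_gt0.
apply: filterS2 (cf _ e'0) (cg _ e'0) => L /= h1 h2 v vT.
have -> : f v * g v - fL L v * gL L v =
    f v * (g v - gL L v) + (f v - fL L v) * (g v - (g v - gL L v)) by ring.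
rewrite (le_lt_trans (ler_nlD _ _))//.
have hf := h1 v vT; have hg := h2 v vT.
have h3 : nl (f v * (g v - gL L v)) <= M * e'.
  by apply: le_trans (ler_nlM _ _) _; rewrite ler_pM ?nl_ge0 ?fM// ltW.
have h4 : nl ((f v - fL L v) * (g v - (g v - gL L v))) <= e' * (N + 1).
  apply: le_trans (ler_nlM _ _) _; rewrite ler_pM ?nl_ge0//; first exact: ltW.
  rewrite (le_trans (ler_nlD _ _))// lerD ?gN// nlN ltW// (lt_le_trans hg)//.
  by rewrite ge_min lexx.
have h5 : e' * (M + N + 1 + 1) <= e.
  by rewrite -ler_pdivlMr// ge_min lexx orbT.
by move: h3 h4 h5 e'0; clear; move: (nl _) (nl _) => x y; lra.
Qed.

Lemma good_sum (I : Type) (r : seq I) (P : pred I) fL f :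
  (forall i, P i -> good (fL i) (f i)) ->
  good (fun L v => \sum_(i <- r | P i) fL i L v) (fun v => \sum_(i <- r | P i) f i v).
Proof.
move=> fP; elim: r => [|i r IH].
  rewrite [X in good X](_ : _ = fun _ _ => 0); last first.
    by apply/funext => L; apply/funext => v; rewrite big_nil.
  rewrite [X in good _ X](_ : _ = fun=> 0); first exact: (@good_cst (fun=> 0) 0 (cvg_cst _)).
  by apply/funext => v; rewrite big_nil.
case Pi : (P i).
  rewrite [X in good X](_ : _ = fun L v => fL i L v + \sum_(i <- r | P i) fL i L v); last first.
    by apply/funext => L; apply/funext => v; rewrite big_cons Pi.
  rewrite [X in good _ X](_ : _ = fun v => f i v + \sum_(i <- r | P i) f i v); last first.
    by apply/funext => v; rewrite big_cons Pi.
  by apply: goodD => //; exact: fP.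
rewrite [X in good X](_ : _ = fun L v => \sum_(i <- r | P i) fL i L v); last first.
  by apply/funext => L; apply/funext => v; rewrite big_cons Pi.
rewrite [X in good _ X](_ : _ = fun v => \sum_(i <- r | P i) f i v)//.
by apply/funext => v; rewrite big_cons Pi.
Qed.

Lemma good_prod (I : Type) (r : seq I) (P : pred I) fL f :
  (forall i, P i -> good (fL i) (f i)) ->
  good (fun L v => \prod_(i <- r | P i) fL i L v) (fun v => \prod_(i <- r | P i) f i v).
Proof.
move=> fP; elim: r => [|i r IH].
  rewrite [X in good X](_ : _ = fun _ _ => 1); last first.
    by apply/funext => L; apply/funext => v; rewrite big_nil.
  rewrite [X in good _ X](_ : _ = fun=> 1); first exact: (@good_cst (fun=> 1) 1 (cvg_cst _)).
  by apply/funext => v; rewrite big_nil.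
case Pi : (P i).
  rewrite [X in good X](_ : _ = fun L v => fL i L v * \prod_(i <- r | P i) fL i L v); last first.
    by apply/funext => L; apply/funext => v; rewrite big_cons Pi.
  rewrite [X in good _ X](_ : _ = fun v => f i v * \prod_(i <- r | P i) f i v); last first.
    by apply/funext => v; rewrite big_cons Pi.
  by apply: goodM => //; exact: fP.
rewrite [X in good X](_ : _ = fun L v => \prod_(i <- r | P i) fL i L v); last first.
  by apply/funext => L; apply/funext => v; rewrite big_cons Pi.
rewrite [X in good _ X](_ : _ = fun v => \prod_(i <- r | P i) f i v)//.
by apply/funext => v; rewrite big_cons Pi.
Qed.

(** The constant of [iterated_integral_le] depends on the contours alone, so a uniform error in the
    integrand controls the error in the integral. *)
Lemma good_cvg fL f s v : good fL f -> torus c v ->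
  iterated_integral c (fL L) s v @[L --> +oo] --> iterated_integral c f s v.
Proof.
move=> [nfL nf cf] vT; apply/cvg_nlP => e e0.
have [len len0 hlen] := iterated_integral_le c s.
have l10 : 0 < len + 1 by rewrite ltr_wpDl.
apply: filterS2 (cf _ (divr_gt0 e0 l10)) (nbhs_pinfty_gt (num_real 0)) => L h /nfL nL.
have nN : nice c (fun v => -1 * fL L v) by apply: niceM => //; exact: nice_cst.
have -> : iterated_integral c f s v - iterated_integral c (fL L) s v =
    iterated_integral c (fun v => f v + -1 * fL L v) s v.
  by rewrite iterated_integralD// iterated_integralZ// mulN1r.
have : len * (e / (len + 1)) < e.
  by rewrite mulrA ltr_pdivrMr// [ltRHS]mulrC ltr_pM2r// ltrDl.
apply: le_lt_trans; apply: hlen => // [|w wT]; first exact: niceD.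
by rewrite mulN1r ltW// h.
Qed.

End Limits.

(** * Graphs and perfect matchings *)

Section Graphs.
Variable n : nat.
Implicit Types (e : 'I_n * 'I_n) (G : {set 'I_n * 'I_n}) (S : {set 'I_n}).
Local Open Scope set_scope.

Definition edge_verts e : {set 'I_n} := [set e.1; e.2].

(** Orienting edges upwards represents each unordered pair once, in the order in which [Cr] occurs
    in the moment formula. *)
Definition edges : {set 'I_n * 'I_n} := [set e : 'I_n * 'I_n | (e.1 < e.2)%N].

Definition verts G : {set 'I_n} := \bigcup_(e in G) edge_verts e.

(** These are the graphs without isolated vertices; connectedness is not meant. *)
Definition spanning G := (G \subset edges) && (verts G == [set: 'I_n]).

Definition blocks G : {set {set 'I_n}} := [set edge_verts e | e in G].

(** Inverse to [blocks]: it passes from a matching as a partition into pairs to the same matching as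
    a graph. *)
Definition matching_edges (P : {set {set 'I_n}}) : {set 'I_n * 'I_n} :=
  [set e : 'I_n * 'I_n | (e.1 < e.2)%N && (edge_verts e \in P)].

Lemma edge_verts_inj : {in edges &, injective edge_verts}.
Proof.
move=> [i j] [k l]; rewrite !inE /= => ij kl /setP E.
have := E i; have := E j; have := E k; have := E l.
rewrite !inE !eqxx !orbT /=.
move=> /orP[]/eqP h1 /orP[]/eqP h2 /esym/orP[]/eqP h3 /esym/orP[]/eqP h4; subst=> //;
  by move: ij kl; rewrite ?ltnn// => h /(ltn_trans h); rewrite ltnn.
Qed.

Lemma card_edge_verts e : e \in edges -> #|edge_verts e| = 2%N.
Proof. by rewrite inE => h; rewrite cards2 neq_ltn h. Qed.

Lemma verts_subset G S :
  (verts G \subset S) = [forall e in G, (e.1 \in S) && (e.2 \in S)].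
Proof.
apply/bigcupsP/forall_inP => h e eG; have := h e eG.
  by rewrite finset.subUset !finset.sub1set.
by rewrite finset.subUset !finset.sub1set.
Qed.

Lemma verts_blocks G : finset.cover (blocks G) = verts G.
Proof. exact: cover_imset. Qed.

(** Union bound over the edges, each of which has two ends. For a spanning graph it gives n <=
    2|G|. *)
Lemma card_verts G : G \subset edges -> (#|verts G| <= #|G|.*2)%N.
Proof.
move=> /fintype.subsetP GE.
have [_ _] := leq_card_cover (blocks G).
have := leq_card_cover (blocks G); rewrite verts_blocks => -[h _].
apply: leq_trans h _; rewrite big_imset /=; last first.
  by move=> e e' /GE eE /GE e'E; exact: edge_verts_inj.
rewrite (eq_bigr (fun=> 2%N)) => [|e /GE]; last exact: card_edge_verts.
by rewrite sum_nat_const muln2.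
Qed.

(** Equality case of the union bound: the size of a cover equals the sum of the sizes of its blocks
    exactly when these are pairwise disjoint. *)
Lemma matching_blocks G : spanning G -> #|G|.*2 = n -> perfect_matching (blocks G).
Proof.
move=> /andP[/fintype.subsetP GE /eqP Gv] Gn.
have inj : {in G &, injective edge_verts}.
  by move=> e e' /GE eE /GE e'E; exact: edge_verts_inj.
have c2 : {in blocks G, forall B : {set 'I_n}, #|B| = 2%N}.
  by move=> B /imsetP[e /GE eE ->]; exact: card_edge_verts.
apply/andP; split; last by apply/forall_inP => B /c2 ->.
rewrite /finset.partition verts_blocks Gv eqxx /=; apply/andP; split.
  have := leq_card_cover (blocks G); rewrite verts_blocks Gv => -[_ <-].
  rewrite (eq_bigr (fun=> 2%N)) => [|B /c2//].
  by rewrite sum_nat_const card_in_imset// cardsT card_ord muln2 Gn.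
by apply/negP => /c2; rewrite cards0.
Qed.

Lemma matching_edgesK G : G \subset edges -> matching_edges (blocks G) = G.
Proof.
move=> /fintype.subsetP GE; apply/setP => e; rewrite inE.
apply/andP/idP => [[e12 /imsetP[e' e'G ee']]|eG].
  have -> : e = e' by apply: edge_verts_inj ee'; [rewrite inE|exact: GE].
  by [].
by split; [have := GE e eG; rewrite inE|exact: imset_f].
Qed.

Lemma blocksK P : perfect_matching P -> blocks (matching_edges P) = P.
Proof.
move=> /andP[_ /forall_inP P2]; apply/setP => B; apply/imsetP/idP => [[e]|BP].
  by rewrite inE => /andP[_ eP] ->.
have /cards2P[i [j [ij BE]]] := P2 _ BP.
move: ij; rewrite neq_ltn => /orP[ij|ji].
  by exists (i, j) => //; rewrite inE /= ij /edge_verts /= -BE.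
by exists (j, i); rewrite ?inE /= ?ji /edge_verts /= finset.setUC -?BE.
Qed.

Lemma matching_edges_spanning P : perfect_matching P ->
  spanning (matching_edges P) /\ #|matching_edges P|.*2 = n.
Proof.
move=> pP; have := pP => /andP[partP /forall_inP P2]; split.
  apply/andP; split; first by apply/fintype.subsetP => e; rewrite !inE => /andP[].
  by rewrite -verts_blocks blocksK// (cover_partition partP).
have := card_partition partP; rewrite cardsT card_ord => /esym; apply: etrans.
rewrite (eq_bigr (fun=> 2%N)) => [|B /P2/eqP//].
rewrite sum_nat_const muln2 -[in RHS](blocksK pP) card_in_imset//.
by move=> e e'; rewrite !inE => /andP[h _] /andP[h' _]; apply: edge_verts_inj; rewrite inE.
Qed.

(** Wick's formula sums over partitions, the expansion of the moments over graphs; the bijection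
    between the two matches them. *)
Lemma sum_perfect_matching (V : nmodType) (f : {set 'I_n * 'I_n} -> V) :
  (\sum_(P | perfect_matching P) f (matching_edges P) =
   \sum_(G | spanning G && (#|G|.*2 == n)) f G)%R.
Proof.
rewrite [RHS](reindex_onto matching_edges blocks) => [|G /andP[/andP[GE _] _]]; last first.
  exact: matching_edgesK.
apply: eq_bigl => P; apply/idP/idP => [pP|/andP[/andP[h /eqP h2] /eqP <-]].
  by have [-> ->] := matching_edges_spanning pP; rewrite blocksK ?eqxx.
exact: matching_blocks.
Qed.

Lemma prod_matching (A : comPzRingType) (F : 'I_n -> A) G :
  spanning G -> #|G|.*2 = n -> (\prod_i F i = \prod_(e in G) (F e.1 * F e.2))%R.
Proof.
move=> sG Gn; have /andP[/fintype.subsetP GE _] := sG.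
have /andP[partP _] := matching_blocks sG Gn.
transitivity (\prod_(i in [set: 'I_n]) F i)%R; first by apply: eq_bigl => i; rewrite inE.
rewrite (set_partition_big _ partP) /= big_imset /=; last first.
  by move=> e e' /GE eE /GE e'E; exact: edge_verts_inj.
apply: eq_bigr => e /GE; rewrite inE => e12.
by rewrite big_setU1 ?big_set1// inE neq_ltn e12.
Qed.

Lemma matching_disjoint G e e' i :
  spanning G -> #|G|.*2 = n -> e \in G -> e' \in G ->
  i \in edge_verts e -> i \in edge_verts e' -> e = e'.
Proof.
move=> sG Gn eG e'G ie ie'; have /andP[/fintype.subsetP GE _] := sG.
have /andP[/and3P[_ /finset.trivIsetP tP _] _] := matching_blocks sG Gn.
apply: edge_verts_inj; [exact: GE|exact: GE|].
apply/eqP/negPn/negP => /(tP _ _ (imset_f _ eG) (imset_f _ e'G)).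
by move=> /pred0P/(_ i); rewrite /= ie ie'.
Qed.

Local Open Scope ring_scope.

Lemma prod_edges (A : comPzRingType) (X : 'I_n -> 'I_n -> A) S :
  \prod_(i in S) \prod_(j in S | (i < j)%N) X i j =
  \prod_(e in edges | (e.1 \in S) && (e.2 \in S)) X e.1 e.2.
Proof.
rewrite pair_big_dep /=; apply: eq_bigl => -[i j] /=; rewrite inE /=.
by case: (i \in S) => //=; rewrite ?andbF// andbC.
Qed.

Lemma prod_1D_edges (A : comPzRingType) (C : 'I_n * 'I_n -> A) (h : A) S :
  \prod_(e in edges | (e.1 \in S) && (e.2 \in S)) (1 + h * C e) =
  \sum_(G : {set 'I_n * 'I_n} | (G \subset edges) && (verts G \subset S))
     h ^+ #|G| * \prod_(e in G) C e.
Proof.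
pose Q := [pred e | (e \in edges) && ((e.1 \in S) && (e.2 \in S))].
rewrite big_mkcond /=.
(* Giving the summand 0 to pairs outside [Q] lets the expansion run over all sets of pairs; those
   not contained in [Q] contribute 0. *)
transitivity (\prod_e ((if Q e then h * C e else 0) + 1)).
  by apply: eq_bigr => e _ /=; case: ifP => _; rewrite addrC ?addr0.
rewrite bigA_distr /= [RHS]big_mkcond /=; apply: eq_big => [G|G _]; first by rewrite inE.
rewrite -big_mkcond /=; case: ifP => [/andP[GE GS]|GN].
  rewrite -prodr_const -big_split /=; apply: eq_bigr => e eG.
  have /forall_inP/(_ e eG) -> : [forall e in G, (e.1 \in S) && (e.2 \in S)].
    by rewrite -verts_subset.
  by rewrite (fintype.subsetP GE).
have [e eG eQ] : exists2 e, e \in G & ~~ Q e.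
  apply/exists_inP; rewrite -negb_forall_in; apply: contraFN GN => /forall_inP GQ.
  rewrite verts_subset; apply/andP; split.
    by apply/fintype.subsetP => e /GQ /andP[].
  by apply/forall_inP => e /GQ /andP[].
by move: eQ; rewrite (bigD1 e)//= => /negbTE ->; rewrite mul0r.
Qed.

(** The sum is the expansion of a product over all i, with factor 1 + 0 for i in [V] and 1 - 1
    otherwise. *)
Lemma sum_supsets (A : comPzRingType) (V : {set 'I_n}) :
  \sum_(S : {set 'I_n} | V \subset S) \prod_(i in ~: S) (-1) =
  (V == [set: 'I_n])%:R :> A.
Proof.
transitivity (\prod_(i : 'I_n) (1 + (if i \in V then 0 else -1)) : A).
  rewrite bigA_distr /= big_mkcond /=; apply: eq_big => [S|S _]; first by rewrite inE.
  case: ifP => [VS|/negbT/subsetPn[i iV iS]].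
    rewrite [LHS]big_mkcond /=; apply: eq_bigr => i _; rewrite inE.
    case iS : (i \in S) => //=; case: ifP => // iV.
    by rewrite (fintype.subsetP VS) in iS.
  by rewrite (bigD1 i)//= (negbTE iS) iV mul0r.
case: eqP => [->|/eqP VT].
  by rewrite big1// => i _; rewrite inE addr0.
have /subsetPn[i _ iV] : ~~ ([set: 'I_n] \subset V) by rewrite finset.subTset.
by rewrite (bigD1 i)//= (negbTE iV) subrr mul0r.
Qed.

(* Inclusion-exclusion: centering the variables kills every graph with an
   isolated vertex. *)
Lemma sum_graphs (A : comPzRingType) (C : 'I_n * 'I_n -> A) (F : 'I_n -> A) (h : A) :
  \sum_(S : {set 'I_n}) (\prod_(i in S) \prod_(j in S | (i < j)%N) (1 + h * C (i, j)) *
     \prod_(i in S) F i) * \prod_(i in ~: S) (- F i) =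
  \sum_(G | spanning G) h ^+ #|G| * (\prod_(e in G) C e * \prod_i F i).
Proof.
transitivity (\sum_(S : {set 'I_n})
    \sum_(G : {set 'I_n * 'I_n} | (G \subset edges) && (verts G \subset S))
    (h ^+ #|G| * (\prod_(e in G) C e * \prod_i F i)) * \prod_(i in ~: S) (-1)).
  apply: eq_bigr => S _; rewrite (prod_edges (fun i j => 1 + h * C (i, j))) /=.
  rewrite (eq_bigr (fun e => 1 + h * C e)) => [|[]//].
  rewrite prod_1D_edges -mulrA big_distrl /=; apply: eq_bigr => G _.
  rewrite -!mulrA; congr (_ * (_ * _)).
  have -> : \prod_(i in ~: S) (- F i) = \prod_(i in ~: S) F i * \prod_(i in ~: S) (-1).
    by rewrite -big_split /=; apply: eq_bigr => i _; rewrite mulrN1.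
  rewrite mulrA; congr (_ * _); rewrite [RHS](bigID (mem S)) /=; congr (_ * _).
  by apply: eq_bigl => i; rewrite inE.
(* For a fixed graph there remains the signed sum over the supersets of its vertex set. *)
rewrite (exchange_big_dep (fun G => G \subset edges)) /=; last by move=> S G _ /andP[].
rewrite [RHS]big_mkcondr /=; apply: eq_bigr => G GE.
under eq_bigl do rewrite GE /=.
rewrite -big_distrr /= sum_supsets.
by case: eqP => _; rewrite ?mulr1 ?mulr0.
Qed.

End Graphs.

(** * Subfamilies of contours and permutations *)

Section Subfamilies.

(** Both lists are strictly increasing and have the same elements. *)
Lemma map_enum_increasing t n (s : 'I_t -> 'I_n) : {homo s : i j / (i < j)%N} ->
  map s (enum 'I_t) = [seq i <- enum 'I_n | i \in codom s].
Proof.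
move=> s_incr.
have so m : sorted (fun i j : 'I_m => (i < j)%N) (enum 'I_m).
  by have := iota_ltn_sorted 0 m; rewrite -val_enum_ord sorted_map.
apply: (@irr_sorted_eq _ (fun i j : 'I_n => (i < j)%N)).
- by move=> j i k; exact: ltn_trans.
- by move=> i; rewrite ltnn.
- exact: homo_sorted (so t).
- by apply: sorted_filter (so n) => j i k; exact: ltn_trans.
- by move=> i; rewrite mem_filter mem_enum andbT codomE.
Qed.

(** The variables are enumerated block by block, so an increasing choice of blocks inherits the
    order of integration. *)
Lemma enum_tagged n (d : 'I_n -> nat) :
  enum {: {i : 'I_n & 'I_(d i)}} =
  flatten [seq [seq Tagged (fun i => 'I_(d i)) x | x <- enum 'I_(d i)] | i <- enum 'I_n].
Proof.
rewrite enumT unlock /= /tag_enum.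
by congr flatten; rewrite enumT; congr (map _ _); apply/funext => i; rewrite enumT.
Qed.

Lemma enum_tagged_increasing t n (d : 'I_n -> nat) (s : 'I_t -> 'I_n) :
  {homo s : i j / (i < j)%N} ->
  [seq Tagged (fun i => 'I_(d i)) (tagged p) | p : {j : 'I_t & 'I_(d (s j))}] =
  [seq p <- enum {: {i : 'I_n & 'I_(d i)}} | tag p \in codom s].
Proof.
move=> s_incr; rewrite /image_mem !enum_tagged map_flatten filter_flatten.
rewrite -(map_comp _ _ (enum 'I_t)) -(map_comp _ _ (enum 'I_n)).
transitivity (flatten [seq [seq Tagged (fun i => 'I_(d i)) x | x <- enum 'I_(d i)]
                 | i <- map s (enum 'I_t)]).
  rewrite -(map_comp _ _ (enum 'I_t)); congr flatten; apply: eq_map => j /=.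
  by rewrite -map_comp.
rewrite map_enum_increasing//; elim: (enum 'I_n) => //= i r IH.
have fE : [seq p <- [seq Tagged (fun i => 'I_(d i)) x | x <- enum 'I_(d i)] |
    tag p \in codom s] =
  if i \in codom s then [seq Tagged (fun i => 'I_(d i)) x | x <- enum 'I_(d i)] else [::].
  rewrite filter_map /=; case: ifP => ic; first by rewrite (eq_filter (a2 := predT)) ?filter_predT.
  by rewrite (eq_filter (a2 := pred0)) ?filter_pred0.
by rewrite fE; case: ifP => _ /=; rewrite IH.
Qed.

Lemma iterated_integral_map (R : realType) (T T' : eqType) (phi : T' -> T)
    (c : T -> contour R) (f : (T' -> R[i]) -> R[i]) s v : injective phi ->
  iterated_integral (c \o phi) f s (v \o phi) =
  iterated_integral c (fun w => f (w \o phi)) (map phi s) v.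
Proof.
move=> phi_inj; elim: s v => //= t s IH v; congr curve_integral; apply/funext => z.
rewrite -IH; congr iterated_integral; apply/funext => t' /=.
by rewrite (inj_eq phi_inj).
Qed.

(** Places the integral over a subfamily among the variables of the full family, where integrals
    over different subfamilies can be multiplied and compared. *)
Lemma family_integral_increasing (R : realType) t n (d : 'I_n -> nat)
    (s : 'I_t -> 'I_n) (g : forall i, multicontour R (d i))
    (f : (forall j, 'rV[R[i]]_(d (s j))) -> R[i]) :
  {homo s : i j / (i < j)%N} ->
  family_integral (fun j => g (s j)) f =
  iterated_integral (fun p : {i : 'I_n & 'I_(d i)} => g (tag p) (tagged p))
    (fun v => f (fun j => \row_m v (existT (fun i => 'I_(d i)) (s j) m)))
    [seq p <- enum {: {i : 'I_n & 'I_(d i)}} | tag p \in codom s] (fun=> 0).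
Proof.
move=> s_incr; rewrite -enum_tagged_increasing// /family_integral.
pose phi (p : {j : 'I_t & 'I_(d (s j))}) := Tagged (fun i => 'I_(d i)) (tagged p).
have s_inj : injective s.
  move=> j k sjk; apply/val_inj/eqP => /=; rewrite eqn_leq.
  by apply/andP; split; rewrite leqNgt; apply/negP => /s_incr; rewrite sjk ltnn.
have phi_inj : injective phi.
  move=> [j x] [k y]; rewrite /phi /= => E.
  have jk : j = k by apply: s_inj; exact: (congr1 (@tag _ _) E).
  move: y E; rewrite -jk => y /eqP; rewrite eq_Tagged /= => /eqP ->.
  by [].
exact: (iterated_integral_map (fun p : {i : 'I_n & 'I_(d i)} => g (tag p) (tagged p))
  (fun v => f (fun j => \row_m v (existT (fun j => 'I_(d (s j))) j m)))
  (enum {: {j : 'I_t & 'I_(d (s j))}}) (fun=> 0) phi_inj).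
Qed.

End Subfamilies.

(** * Sorting an index, and invariance of Gaussian moments under permutations *)

Section Permutations.

Lemma sorting_permutation n q (K : 'I_n -> 'I_q) :
  exists s : {perm 'I_n}, nondecreasing_idx (K \o s).
Proof.
pose le := [rel i j : 'I_n | (K i <= K j)%N].
have sz : size (sort le (enum 'I_n)) == n by rewrite size_sort size_enum_ord.
pose t := Tuple sz.
have : perm_eq t (ord_tuple n) by rewrite /= perm_sort.
move=> /tuple_permP[s ts]; exists s => i j ij.
have tE k : tnth t k = s k.
  have := congr1 (fun r => nth k r k) ts.
  by rewrite -tnth_nth (nth_map k) ?size_enum_ord// nth_ord_enum tnth_ord_tuple.
have : sorted le t by apply: sort_sorted => k m; exact: leq_total.
rewrite /comp -!tE !(tnth_nth i) => st.
apply: (sorted_leq_nth _ _ i st) => //; rewrite ?inE ?size_tuple ?ltn_ord//.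
- by move=> a b c; exact: leq_trans.
- by move=> a; exact: leqnn.
Qed.

Section BlockWeights.
Variables (A : comPzRingType) (n : nat).
Implicit Types (X : 'I_n -> 'I_n -> A) (P : {set {set 'I_n}}).

(* For a two-element block this is [X i j], whichever way the block is ordered
   when [X] is symmetric. *)
Definition block_weight X (B : {set 'I_n}) : A :=
  \prod_(i in B) \prod_(j in B | (i < j)%N) X i j.

Lemma block_weight2 X i j : (forall i j, X i j = X j i) -> i != j ->
  block_weight X [set i; j]%SET = X i j.
Proof.
move=> Xsym ij; wlog lt_ij : i j ij / (i < j)%N.
  move=> H; have : (i < j)%N || (j < i)%N by rewrite -neq_ltn.
  by move=> /orP[/H->//|/H]; rewrite eq_sym finset.setUC Xsym => ->.
rewrite /block_weight big_setU1 ?inE//= big_set1 !big_mkcondr /=.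
rewrite !big_setU1 ?inE//= !big_set1 !ltnn lt_ij.
by rewrite ltnNge (ltnW lt_ij) /= !mul1r !mulr1.
Qed.

(** Removes the condition i < j within a pair, which a permutation does not respect. *)
Lemma prod_perfect_matching X P : (forall i j, X i j = X j i) -> perfect_matching P ->
  \prod_(e : 'I_n * 'I_n | (e.1 < e.2)%N && ([set e.1; e.2]%SET \in P)) X e.1 e.2 =
  \prod_(B in P) block_weight X B.
Proof.
move=> Xsym pP; rewrite -[in RHS](blocksK pP) big_imset /=; last first.
  move=> e e'; rewrite !inE => /andP[e12 _] /andP[e12' _].
  by apply: edge_verts_inj; rewrite inE.
apply: eq_big => [e|e /andP[e12 _]]; first by rewrite inE.
by rewrite block_weight2// neq_ltn e12.
Qed.

End BlockWeights.

(** The permutation acts on the matchings themselves. Symmetry of [Sigma] enters because it may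
    reverse the order within a pair. *)
Lemma gaussian_moment_perm (R : realType) q (Sigma : 'M[R[i]]_q) n (K : 'I_n -> 'I_q)
    (s : {perm 'I_n}) : Sigma^T = Sigma ->
  gaussian_moment Sigma (K \o s) = gaussian_moment Sigma K.
Proof.
move=> Ssym.
have Sc i j : Sigma i j = Sigma j i by rewrite -[in LHS]Ssym mxE.
pose img (P : {set {set 'I_n}}) := [set [set s x | x in B] | B : {set 'I_n} in P]%SET.
have s_inj : injective (fun B : {set 'I_n} => [set s x | x in B]%SET).
  exact/imset_inj/perm_inj.
have img_inj : injective img by exact: imset_inj.
have imgP P : perfect_matching (img P) = perfect_matching P.
  rewrite /perfect_matching; congr (_ && _).
    rewrite -[RHS](imset_partition _ _ (@perm_inj _ s)); congr finset.partition.
    by apply/esym/setP => i; rewrite inE -(permKV s i) imset_f ?inE.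
  apply/forall_inP/forall_inP => [h B BP|h _ /imsetP[B BP ->]].
    by have := h _ (imset_f _ BP); rewrite card_imset//; exact: perm_inj.
  by rewrite card_imset ?h//; exact: perm_inj.
rewrite /gaussian_moment [RHS](reindex_inj img_inj) /=; apply: eq_big => [P|P pP].
  by rewrite imgP.
rewrite (prod_perfect_matching (X := fun i j => Sigma (K (s i)) (K (s j))))//.
rewrite (prod_perfect_matching (X := fun i j => Sigma (K i) (K j))) ?imgP//.
rewrite big_imset /=; last by move=> B B' _ _; exact: s_inj.
apply: eq_bigr => B BP; have /andP[_ /forall_inP/(_ B BP)/cards2P[i [j [ij ->]]]] := pP.
rewrite imsetU1 imset_set1 !block_weight2//.
by rewrite (inj_eq (@perm_inj _ s)).
Qed.

End Permutations.

(** * Expansion over graphs *)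

Section Blocks.
Variables (R : realType) (n : nat) (d : 'I_n -> nat).
Variable g : forall i, multicontour R (d i).

Local Notation T := {i : 'I_n & 'I_(d i)}.

Definition family_contour (p : T) : contour R := @g (tag p) (tagged p).

Definition vars (v : T -> R[i]) i : 'rV[R[i]]_(d i) :=
  \row_m v (existT (fun i => 'I_(d i)) i m).

Lemma vars_torus v i : torus family_contour v -> mtrace (@g i) (vars v i).
Proof. by move=> vT m; rewrite mxE; exact: (vT (existT _ i m)). Qed.

Lemma vars_ball v w i (e : R) : 0 < e -> (forall t, nl (v t - w t) < e) ->
  ball (vars v i) e%:C (vars w i).
Proof. by move=> e0 vw; split=> [|j m]; [rewrite ltcR|rewrite !mxE; exact: nl_ball]. Qed.

Lemma depends_on_vars i (X : Type) (f : 'rV[R[i]]_(d i) -> X) v w :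
  (forall t, tag t == i -> v t = w t) -> f (vars v i) = f (vars w i).
Proof. by move=> vw; congr f; apply/rowP => m; rewrite !mxE vw/=. Qed.

Lemma compact_mtrace m (mc : multicontour R m) : compact (mtrace mc).
Proof. exact: (@rV_compact _ _ (fun k => trace (mc k)) (fun k => @compact_trace _ (mc k))). Qed.

(** Stated for a general nonexpanding [phi], so as to cover one block of variables (for [F]) as well
    as a pair of blocks (for [Cr]). *)
Lemma nice_comp (U : pseudoMetricType R[i]) (A : set U) (f : U -> R[i])
    (phi : (T -> R[i]) -> U) :
  compact A -> {within A, continuous f} ->
  (forall v, torus family_contour v -> A (phi v)) ->
  (forall v w (e : R), 0 < e -> (forall t, nl (v t - w t) < e) -> ball (phi v) e%:C (phi w)) ->
  nice family_contour (fun v => f (phi v)).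
Proof.
move=> cA cf phiA phiB; split.
  have [M hM] := compact_bounded_nl cA cf.
  by exists `|M| => // v vT; apply: le_trans (hM _ (phiA _ vT)) (ler_norm _).
move=> e e0; have [r r0 hr] := compact_unif_continuous_nl cA cf e0.
exists r => // v w vT wT vw; apply: hr; [exact: phiA|exact: phiA|exact: phiB].
Qed.

Lemma good_comp (U : pseudoMetricType R[i]) (A : set U) (fL : R -> U -> R[i])
    (f : U -> R[i]) (phi : (T -> R[i]) -> U) :
  compact A -> (forall L, 0 < L -> {within A, continuous (fL L)}) ->
  {within A, continuous f} -> {uniform A, fL L @[L --> +oo] --> f} ->
  (forall v, torus family_contour v -> A (phi v)) ->
  (forall v w (e : R), 0 < e -> (forall t, nl (v t - w t) < e) -> ball (phi v) e%:C (phi w)) ->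
  good family_contour (fun L v => fL L (phi v)) (fun v => f (phi v)).
Proof.
move=> cA cfL cf fLf phiA phiB; split=> [L L0||e e0].
- exact: nice_comp cA (cfL _ L0) phiA phiB.
- exact: nice_comp cA cf phiA phiB.
apply: (@filterS _ (pinfty_nbhs R) _ _ _ _ (uniform_nl fLf e0)) => L h v vT.
by apply: h; exact: phiA.
Qed.

Lemma good_vars i (fL : R -> 'rV[R[i]]_(d i) -> R[i]) f :
  (forall L, 0 < L -> {within mtrace (@g i), continuous (fL L)}) ->
  {within mtrace (@g i), continuous f} ->
  {uniform mtrace (@g i), fL L @[L --> +oo] --> f} ->
  good family_contour (fun L v => fL L (vars v i)) (fun v => f (vars v i)).
Proof.
move=> cfL cf fLf; apply: (good_comp (phi := vars^~ i) _ cfL cf fLf).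
- exact: compact_mtrace.
- by move=> v; exact: vars_torus.
- by move=> v w e; exact: vars_ball.
Qed.

Lemma good_vars2 i j (fL : R -> 'rV[R[i]]_(d i) * 'rV[R[i]]_(d j) -> R[i]) f :
  (forall L, 0 < L -> {within mtrace (@g i) `*` mtrace (@g j), continuous (fL L)}) ->
  {within mtrace (@g i) `*` mtrace (@g j), continuous f} ->
  {uniform mtrace (@g i) `*` mtrace (@g j), fL L @[L --> +oo] --> f} ->
  good family_contour (fun L v => fL L (vars v i, vars v j))
    (fun v => f (vars v i, vars v j)).
Proof.
move=> cfL cf fLf.
apply: (good_comp (phi := fun v => (vars v i, vars v j)) _ cfL cf fLf).
- by apply: compact_setX; exact: compact_mtrace.
- by move=> v vT; split; exact: vars_torus.
- by move=> v w e e0 vw; split; exact: vars_ball.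
Qed.

End Blocks.

(** * Integrals attached to blocks, edges and graphs *)

Section GraphIntegrals.
Variables (R : realType) (n : nat) (T : finType) (tg : T -> 'I_n) (c : T -> contour R).
(* [family_integral] starts from the assignment [0], which need not lie on the
   contours, where the integrands are controlled; hence the base point [v0]. *)
Variable v0 : T -> R[i].
Hypothesis v0T : torus c v0.

Local Open Scope set_scope.

Definition block_integral (S : {set 'I_n}) (f : (T -> R[i]) -> R[i]) : R[i] :=
  iterated_integral c f [seq p <- enum T | tg p \in S] v0.

Definition on_block (S : {set 'I_n}) : pred T := [pred p | tg p \in S].

(** All variables on which [f] depends are integrated, so the base point is irrelevant; this
    replaces the initial value 0 of [family_integral] by [v0]. *)
Lemma iterated_integral_base S f v :
  depends_on (on_block S) f ->
  iterated_integral c f [seq p <- enum T | tg p \in S] v = block_integral S f.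
Proof.
move=> fS; rewrite /block_integral; apply: (depends_on_iterated_integral _ fS) => p /andP[pS].
by rewrite mem_filter mem_enum andbT => /negP[]; exact: pS.
Qed.

Variables (C : 'I_n * 'I_n -> (T -> R[i]) -> R[i]) (F : 'I_n -> (T -> R[i]) -> R[i]).
Hypothesis F_dep : forall i, depends_on (on_block [set i]) (F i).
Hypothesis C_dep : forall e, depends_on (on_block (edge_verts e)) (C e).

Lemma depends_on_F (S : {set 'I_n}) i : i \in S -> depends_on (on_block S) (F i).
Proof.
move=> iS; apply: (depends_on_sub _ (@F_dep i)) => p.
by rewrite !inE => /eqP ->.
Qed.

Lemma depends_on_C (S : {set 'I_n}) e : e.1 \in S -> e.2 \in S -> depends_on (on_block S) (C e).
Proof.
move=> e1 e2; apply: (depends_on_sub _ (@C_dep e)) => p.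
by rewrite !inE => /orP[]/eqP ->.
Qed.

Definition block_integrand (h : R[i]) (S : {set 'I_n}) (v : T -> R[i]) : R[i] :=
  \prod_(i in S) \prod_(j in S | (i < j)%N) (1 + h * C (i, j) v) *
  \prod_(i in S) F i v.

Lemma depends_on_block_integrand h S : depends_on (on_block S) (block_integrand h S).
Proof.
move=> v w vw; congr (_ * _); last first.
  by apply: eq_bigr => i iS; exact: depends_on_F iS _ _ vw.
apply: eq_bigr => i iS; apply: eq_bigr => j /andP[jS _].
by rewrite (depends_on_C (e := (i, j)) iS jS vw).
Qed.

Hypothesis F_nice : forall i, nice c (F i).
Hypothesis C_nice : forall e, e \in edges n -> nice c (C e).

Lemma nice_block_integrand h S : nice c (block_integrand h S).
Proof.
apply: niceM; last by apply: nice_prod.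
apply: nice_prod => i _; apply: nice_prod => j /andP[_ ij].
by apply: niceD; [exact: nice_cst|apply: niceM; [exact: nice_cst|apply: C_nice; rewrite inE]].
Qed.

(** The moment over [S] and the means outside [S] involve disjoint blocks, which together exhaust
    all variables. *)
Lemma block_integral_singletons S h :
  block_integral S (block_integrand h S) *
    \prod_(i in ~: S) (- block_integral [set i] (F i)) =
  block_integral [set: 'I_n]
    (fun v => block_integrand h S v * \prod_(i in ~: S) (- F i v)).
Proof.
have nFN i : nice c (fun v => - F i v).
  rewrite [X in nice c X](_ : _ = fun v => -1 * F i v).
    by apply: niceM => //; exact: nice_cst.
  by apply/funext => v; rewrite mulN1r.
rewrite {3}/block_integral (eq_filter (a2 := predT)) ?filter_predT => [|p]; last by rewrite /= inE.
have dS v w : (forall t, predC (on_block S) t -> v t = w t) ->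
    \prod_(i in ~: S) (- F i v) = \prod_(i in ~: S) (- F i w).
  move=> vw; apply: eq_bigr => i iS; congr (- _); apply: F_dep => p.
  by rewrite /on_block /= inE => /eqP pi; apply: vw; rewrite /on_block /= pi -finset.in_setC.
have n1 := nice_block_integrand h S.
have n2 : nice c (fun v => \prod_(i in ~: S) (- F i v)) by apply: nice_prod.
have d1 : depends_on (on_block S) (block_integrand h S) by exact: depends_on_block_integrand.
rewrite (iterated_integralM _ n1 n2 d1 dS v0T).
congr (_ * _).
rewrite -big_enum /=.
have -> : (fun v => \prod_(i in ~: S) - F i v) = (fun v => \prod_(i <- enum (~: S)) - F i v).
  by apply/funext => v; rewrite big_enum.
(* The variables outside [S] are regrouped as the union of the single blocks i in the complement of
   [S]. *)
rewrite (eq_filter (a2 := fun p => has (fun i => on_block [set i] p) (enum (~: S)))); last first.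
  move=> p /=; apply/idP/hasP => [pS|[j]]; last first.
    by rewrite mem_enum inE => jS; rewrite /on_block /= inE => /eqP ->.
  by exists (tg p); rewrite ?mem_enum /on_block /= ?inE.
rewrite (iterated_integral_prod (A := fun i => on_block [set i])
    (f := fun i v => - F i v))//; last 3 first.
- exact: enum_uniq.
- by move=> i v w vw; congr (- _); exact: F_dep vw.
- by move=> i j _ _ p; rewrite /on_block /= !inE => /eqP <- /eqP.
apply: eq_bigr => i _; rewrite -mulN1r -iterated_integralZ//.
by congr iterated_integral; apply/funext => v; rewrite mulN1r.
Qed.

Lemma centered_block_integrals h :
  \sum_(S : {set 'I_n}) block_integral S (block_integrand h S) *
    \prod_(i in ~: S) (- block_integral [set i] (F i)) =
  block_integral [set: 'I_n] (fun v =>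
    \sum_(G | spanning G) h ^+ #|G| * (\prod_(e in G) C e v * \prod_i F i v)).
Proof.
under eq_bigr do rewrite block_integral_singletons.
rewrite -iterated_integral_sum//; last first.
  move=> S _; apply: niceM; first exact: nice_block_integrand.
  apply: nice_prod => i _; rewrite [X in nice c X](_ : _ = fun v => -1 * F i v).
    by apply: niceM => //; exact: nice_cst.
  by apply/funext => v; rewrite mulN1r.
congr iterated_integral; apply/funext => v.
exact: (sum_graphs (fun e => C e v) (fun i => F i v) h).
Qed.

(** For the limiting data this is the covariance attached to the two ends of the edge. *)
Definition edge_integral e : R[i] :=
  block_integral (edge_verts e) (fun v => C e v * F e.1 v * F e.2 v).

(** In a perfect matching each block of variables belongs to exactly one edge, so the integral
    splits over the edges. *)
Lemma matching_integral G : spanning G -> #|G|.*2 = n ->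
  block_integral [set: 'I_n] (fun v => \prod_(e in G) C e v * \prod_i F i v) =
  \prod_(e in G) edge_integral e.
Proof.
move=> sG Gn; have /andP[/fintype.subsetP GE /eqP Gv] := sG.
rewrite -big_enum /=.
rewrite -(iterated_integral_prod (A := fun e => on_block (edge_verts e))
  (f := fun e v => C e v * F e.1 v * F e.2 v))//; last 4 first.
- exact: enum_uniq.
- move=> e; rewrite mem_enum => /GE eE.
  by apply: niceM => //; apply: niceM => //; exact: C_nice.
- move=> e v w vw; rewrite (C_dep vw) !(depends_on_F _ vw)//.
    by rewrite !inE eqxx orbT.
  by rewrite !inE eqxx.
- move=> e e'; rewrite !mem_enum => eG e'G p /=.
  exact: (matching_disjoint sG Gn eG e'G).
rewrite /block_integral; congr iterated_integral.
  apply/funext => v; rewrite (prod_matching _ sG Gn) -big_split /= big_enum /=.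
  by apply: eq_bigr => e _; rewrite mulrA.
apply: eq_filter => p; rewrite inE; apply/esym/hasP.
have : tg p \in verts G by rewrite Gv inE.
by move=> /bigcupP[e eG pe]; exists e; rewrite ?mem_enum.
Qed.

End GraphIntegrals.

Lemma cvg_exprn0 (R : realType) (a : R -> R[i]) (m : nat) :
  a L @[L --> +oo] --> 0 -> a L ^+ m @[L --> +oo] --> ((m == 0%N)%:R : R[i]).
Proof.
move=> a0; elim: m => [|m IH]; first by under eq_fun do rewrite expr0; exact: cvg_cst.
under eq_fun do rewrite exprS.
have -> : (m.+1 == 0%N)%:R = 0 * (m == 0%N)%:R :> R[i] by rewrite mul0r.
exact: (@cvgM R[i] _ _ _ _ _ _ _ a0 IH).
Qed.

Section GraphLimit.
Variables (R : realType) (n : nat) (T : finType) (tg : T -> 'I_n) (c : T -> contour R).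
Variable v0 : T -> R[i].
Hypothesis v0T : torus c v0.
Variables (CL : R -> 'I_n * 'I_n -> (T -> R[i]) -> R[i]) (FL : R -> 'I_n -> (T -> R[i]) -> R[i]).
Variables (C : 'I_n * 'I_n -> (T -> R[i]) -> R[i]) (F : 'I_n -> (T -> R[i]) -> R[i]).
Hypothesis F_dep : forall i, depends_on (on_block tg [set i]%SET) (F i).
Hypothesis C_dep : forall e, depends_on (on_block tg (edge_verts e)) (C e).
Hypothesis FL_good : forall i, good c (FL^~ i) (F i).
Hypothesis CL_good : forall e, e \in edges n -> good c (CL^~ e) (C e).

(* A spanning graph has at least n/2 edges, hence the exponent below is a genuine
   difference; it vanishes only for perfect matchings. *)
Lemma graphs_cvg (a : R -> R[i]) : a L @[L --> +oo] --> 0 ->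
  block_integral tg c v0 [set: 'I_n]%SET (fun v =>
    \sum_(G | spanning G) a L ^+ (#|G|.*2 - n) *
      (\prod_(e in G) CL L e v * \prod_i FL L i v)) @[L --> +oo] -->
  \sum_(G : {set 'I_n * 'I_n} | spanning G && (#|G|.*2 == n))
    \prod_(e in G) edge_integral tg c v0 C F e.
Proof.
move=> a0.
have nF i : nice c (F i) by have [] := FL_good i.
have nC e : e \in edges n -> nice c (C e) by move=> /CL_good[].
have gP (G : {set 'I_n * 'I_n}) : spanning G ->
    good c (fun L v => \prod_(e in G) CL L e v * \prod_i FL L i v)
      (fun v => \prod_(e in G) C e v * \prod_i F i v).
  move=> /andP[/fintype.subsetP GE _]; apply: goodM; apply: good_prod => // e /GE.
  exact: CL_good.
(* The right-hand side becomes a single integral whose weights are the limits of the powers of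
   [a L]: 1 for a matching, 0 otherwise. *)
have -> : \sum_(G : {set 'I_n * 'I_n} | spanning G && (#|G|.*2 == n))
    \prod_(e in G) edge_integral tg c v0 C F e =
  block_integral tg c v0 [set: 'I_n]%SET (fun v =>
    \sum_(G | spanning G) (#|G|.*2 - n == 0)%N%:R *
      (\prod_(e in G) C e v * \prod_i F i v)).
  rewrite /block_integral iterated_integral_sum//; last first.
    by move=> G /gP[_ nG _]; apply: niceM => //; exact: nice_cst.
  rewrite big_mkcondr /=; apply: eq_bigr => G sG.
  have [_ nG _] := gP G sG.
  rewrite iterated_integralZ//; case: eqP => [Gn|/eqP Gn].
    by rewrite Gn subnn eqxx mul1r -matching_integral.
  have /andP[/card_verts h /eqP Gv] := sG.
  move: h; rewrite Gv cardsT card_ord leq_eqVlt eq_sym (negbTE Gn) /= => h.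
  by rewrite subn_eq0 leqNgt h mul0r.
apply: good_cvg => //; apply: good_sum => G sG; apply: goodM; last exact: gP.
by apply: good_cst; exact: cvg_exprn0.
Qed.

End GraphLimit.

Lemma expectation_normalized (R : realType) (q n : nat) (E : {scalar mpoly q R[i]})
    (K : 'I_n -> 'I_q) (k : 'I_n -> R[i]) :
  E (\prod_(i < n) normalized E (k i) (K i)) =
  (\prod_(i < n) (k i)^-1) *
  \sum_(S : {set 'I_n}) E (\prod_(i in S) xi R (K i)) *
    \prod_(i in (~: S)%SET) (- E (xi R (K i))).
Proof.
rewrite /normalized scaler_prod linearZ /=; congr (_ * _).
rewrite (eq_bigr (fun i => xi R (K i) + mpolyC q (- E (xi R (K i))))); last first.
  by move=> i _; rewrite mpolyCN.
rewrite bigA_distr linear_sum /=; apply: eq_big => [S|S _]; first by rewrite inE.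
have -> : \prod_i (if i \in S then xi R (K i) else mpolyC q (- E (xi R (K i)))) =
    (\prod_(i in (~: S)%SET) - E (xi R (K i))) *: \prod_(i in S) xi R (K i).
  rewrite -mul_mpolyC rmorph_prod /= mulrC (bigID (mem S)) /=; congr (_ * _).
    by apply: eq_bigr => i ->.
  by apply: eq_big => [i|i /negbTE ->//]; rewrite inE.
by rewrite linearZ /= mulrC.
Qed.

Lemma enum_val_increasing n (S : {set 'I_n}) :
  {homo (enum_val : 'I_#|S| -> 'I_n) : i j / (i < j)%N >-> (i < j)%N}.
Proof.
move=> i j ij; rewrite /enum_val.
set x0 := enum_default i; rewrite (set_nth_default x0) -?cardE//.
apply: (sorted_ltn_nth (leT := fun i j : 'I_n => (i < j)%N)); rewrite ?inE -?cardE//.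
  by move=> x y z; exact: ltn_trans.
rewrite /enum_mem; apply: sorted_filter; first by move=> x y z; exact: ltn_trans.
have := iota_ltn_sorted 0 n; rewrite -val_enum_ord sorted_map.
by rewrite enumT.
Qed.

Lemma powR_decay (R : realType) (p : R) : 0 < p ->
  ((L `^ (- p))%:C : R[i]) @[L --> +oo] --> (0 : R[i]).
Proof.
move=> p0; apply/cvg_nlP => e e0.
(* The threshold e^(-1/p) is the solution of L^(-p) = e. *)
apply: filterS (nbhs_pinfty_gt (num_real (e^-1 `^ p^-1))) => L hL.
have L0 : 0 < L by apply: le_lt_trans hL; exact: powR_ge0.
rewrite sub0r nlN nl_real ger0_norm ?powR_ge0// powRN invf_plt ?posrE ?powR_gt0//.
have -> : e^-1 = (e^-1 `^ p^-1) `^ p by rewrite -powRrM mulVf ?powRr1 ?lt0r_neq0 ?invr_ge0// ltW.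
by apply: gt0_ltr_powR => //; rewrite nnegrE ?powR_ge0// ltW.
Qed.

Lemma sum_matchings2 (V : nmodType) (f : {set 'I_2 * 'I_2} -> V) :
  \sum_(G : {set 'I_2 * 'I_2} | spanning G && (#|G|.*2 == 2)%N) f G =
  f [set (ord0, ord_max)]%SET.
Proof.
have edges2 : edges 2 = [set (ord0, ord_max)]%SET.
  apply/setP => -[[[|[|i]] hi] [[|[|j]] hj]]; rewrite !inE //=.
apply: big_pred1 => G; apply/andP/eqP => [[/andP[]]|->]; last first.
  rewrite cards1 /spanning edges2 fintype.subxx /=; split=> //.
  apply/eqP/setP => i; rewrite /verts big_set1 /edge_verts /= !inE.
  by case: i => [[|[|i]] hi].
rewrite edges2 finset.subset1 => /orP[/eqP//|/eqP ->].
by rewrite cards0.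
Qed.

(** * Convergence of the normalized moments *)

Unset Implicit Arguments.

Section Assembly.
Variables (R : realType) (q : nat).
Variable E : R -> {scalar mpoly q R[i]}.
Hypothesis E1 : forall L : R, 0 < L -> E L 1 = 1.
Variable l : 'I_q -> nat.
Variable aleph : forall n (K : 'I_n -> 'I_q), set (forall i : 'I_n, multicontour R (l (K i))).
Hypothesis aleph_sub : forall n (K : 'I_n -> 'I_q) t (s : 'I_t -> 'I_n) g,
  (0 < t)%N -> nondecreasing_idx K -> {homo s : i j / (i < j)%N} -> aleph n K g ->
  aleph t (fun j => K (s j)) (fun j => g (s j)).
Variables (F : R -> forall k : 'I_q, 'rV[R[i]]_(l k) -> R[i]).
Variables (Flim : forall k : 'I_q, 'rV[R[i]]_(l k) -> R[i]).
Hypothesis F_cont : forall n (K : 'I_n -> 'I_q) g (i : 'I_n) (L : R),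
  nondecreasing_idx K -> aleph n K g -> 0 < L ->
  {within mtrace (g i), continuous (F L (K i))}.
Hypothesis Flim_cont : forall n (K : 'I_n -> 'I_q) g (i : 'I_n),
  nondecreasing_idx K -> aleph n K g ->
  {within mtrace (g i), continuous (Flim (K i))}.
Hypothesis F_cvg : forall n (K : 'I_n -> 'I_q) g (i : 'I_n),
  nondecreasing_idx K -> aleph n K g ->
  {uniform mtrace (g i), F L (K i) @[L --> +oo] --> Flim (K i)}.
Variable Cr : R -> forall k r : 'I_q, 'rV[R[i]]_(l k) * 'rV[R[i]]_(l r) -> R[i].
Variable Crlim : forall k r : 'I_q, 'rV[R[i]]_(l k) * 'rV[R[i]]_(l r) -> R[i].
Hypothesis Cr_cont : forall n (K : 'I_n -> 'I_q) g (i j : 'I_n) (L : R),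
  nondecreasing_idx K -> aleph n K g -> (i < j)%N -> 0 < L ->
  {within mtrace (g i) `*` mtrace (g j), continuous (Cr L (K i) (K j))}.
Hypothesis Crlim_cont : forall n (K : 'I_n -> 'I_q) g (i j : 'I_n),
  nondecreasing_idx K -> aleph n K g -> (i < j)%N ->
  {within mtrace (g i) `*` mtrace (g j), continuous (Crlim (K i) (K j))}.
Hypothesis Cr_cvg : forall n (K : 'I_n -> 'I_q) g (i j : 'I_n),
  nondecreasing_idx K -> aleph n K g -> (i < j)%N ->
  {uniform mtrace (g i) `*` mtrace (g j),
    Cr L (K i) (K j) @[L --> +oo] --> Crlim (K i) (K j)}.
Variable c : R -> 'I_q -> R[i].
Hypothesis c_neq0 : forall L k, 0 < L -> c L k != 0.
Variable gamma : R.
Hypothesis gamma_gt0 : 0 < gamma.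
Hypothesis moment_formula : forall n (K : 'I_n -> 'I_q),
  (0 < n)%N -> nondecreasing_idx K ->
  exists2 LK : R, 0 < LK & forall L, LK < L -> forall g, aleph n K g ->
    E L (\prod_(i < n) xi R (K i)) =
    (\prod_(i < n) c L (K i)) *
    family_integral g (moment_integrand (F L) (Cr L) (L `^ (- gamma)) (K := K)).

Local Notation a L := ((L `^ (- gamma / 2))%:C).
Local Notation eta L := (fun k => normalized (E L) (c L k * a L) k).

Section Family.
Variables (n : nat) (K : 'I_n -> 'I_q) (g : forall i : 'I_n, multicontour R (l (K i))).
Hypotheses (K_nd : nondecreasing_idx K) (g_aleph : aleph n K g).

Local Notation T := {i : 'I_n & 'I_(l (K i))}.
Local Notation ct := (family_contour g).
Local Notation tg := (fun p : T => tag p).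

Let FL L i (v : T -> R[i]) := F L (K i) (vars v i).
Let FI i (v : T -> R[i]) := Flim (K i) (vars v i).
Let CL L (e : 'I_n * 'I_n) (v : T -> R[i]) :=
  Cr L (K e.1) (K e.2) (vars v e.1, vars v e.2).
Let CI (e : 'I_n * 'I_n) (v : T -> R[i]) :=
  Crlim (K e.1) (K e.2) (vars v e.1, vars v e.2).

Let dep1 i (f : 'rV[R[i]]_(l (K i)) -> R[i]) :
  depends_on (on_block tg [set i]%SET) (fun v => f (vars v i)).
Proof.
by move=> v w vw; apply: depends_on_vars => p pi; apply: vw; rewrite /on_block /= inE.
Qed.

Let dep2 e (f : 'rV[R[i]]_(l (K e.1)) * 'rV[R[i]]_(l (K e.2)) -> R[i]) :
  depends_on (on_block tg (edge_verts e)) (fun v => f (vars v e.1, vars v e.2)).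
Proof.
move=> v w vw.
have h i : i \in edge_verts e -> vars v i = vars w i.
  move=> ie; apply: (depends_on_vars id) => p /eqP pi; apply: vw.
  by rewrite /on_block /= pi.
by rewrite !h// !inE eqxx ?orbT.
Qed.

Let F_good i : good ct (FL^~ i) (FI i).
Proof.
apply: (good_vars (fL := fun L => F L (K i)) (f := Flim (K i))).
- by move=> L; exact: F_cont.
- exact: Flim_cont.
- exact: F_cvg.
Qed.

Let C_good e : e \in edges n -> good ct (CL^~ e) (CI e).
Proof.
rewrite inE => e12.
apply: (good_vars2 (fL := fun L => Cr L (K e.1) (K e.2)) (f := Crlim (K e.1) (K e.2))).
- by move=> L; exact: Cr_cont.
- exact: Crlim_cont.
- exact: Cr_cvg.
Qed.

Let h L : R[i] := (L `^ (- gamma))%:C.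

Variable v0 : T -> R[i].
Hypothesis v0T : torus ct v0.

(** [enum_val] lists [S] increasingly, so pairs of positions j < k correspond to pairs i < j of
    elements of [S]. *)
Lemma subfamily_integral (S : {set 'I_n}) L :
  family_integral (fun j : 'I_#|S| => g (enum_val j))
    (moment_integrand (F L) (Cr L) (L `^ (- gamma)) (K := fun j => K (enum_val j))) =
  block_integral tg ct v0 S (block_integrand (CL L) (FL L) (h L) S).
Proof.
rewrite (family_integral_increasing g _ (@enum_val_increasing _ S)).
rewrite -(@iterated_integral_base _ _ _ tg ct v0 S _ (fun=> 0)); last first.
  by apply: depends_on_block_integrand => [i|e]; [exact: dep1|exact: dep2].
rewrite (eq_filter (a2 := fun p : T => tag p \in S)); last first.
  move=> p; apply/codomP/idP => [[j ->]|pS]; first exact: enum_valP.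
  by exists (enum_rank_in pS (tag p)); rewrite enum_rankK_in.
congr iterated_integral; apply/funext => v.
rewrite /block_integrand /moment_integrand; congr (_ * _); last first.
  by rewrite [RHS]big_enum_val.
rewrite [RHS]big_enum_val; apply: eq_bigr => i _.
rewrite [RHS]big_enum_val_cond /=; apply: eq_bigl => j.
apply/idP/idP => [|ij]; first exact: enum_val_increasing.
rewrite ltnNge; apply: contraTN ij; rewrite leq_eqVlt -leqNgt => /orP[/eqP/val_inj ->//|].
by move=> /(@enum_val_increasing _ S)/ltnW.
Qed.

(** The threshold of the moment formula depends on the index, but only finitely many sets [S] occur,
    so one threshold serves them all. *)
Lemma eventually_moment :
  \forall L \near +oo, forall S : {set 'I_n},
    E L (\prod_(i in S) xi R (K i)) =
    (\prod_(i in S) c L (K i)) *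
      block_integral tg ct v0 S (block_integrand (CL L) (FL L) (h L) S).
Proof.
apply: filter_forall => S.
have [->|/set0Pn[i iS]] := eqVneq S finset.set0.
  (* The moment formula does not cover the empty [S], where both sides are 1 by normalization. *)
  apply: filterS (nbhs_pinfty_gt (num_real 0)) => L L0.
  rewrite !big_set0 E1// mul1r /block_integral.
  rewrite (eq_filter (a2 := pred0)) => [|p]; last by rewrite inE.
  by rewrite filter_pred0 /= /block_integrand !big_set0 mulr1.
have S0 : (0 < #|S|)%N by apply/card_gt0P; exists i.
have K'nd : nondecreasing_idx (fun j : 'I_#|S| => K (enum_val j)).
  move=> j k; rewrite leq_eqVlt => /orP[/eqP/val_inj ->//|jk].
  by apply: K_nd; apply/ltnW/enum_val_increasing.
have [LK LK0 H] := moment_formula _ _ S0 K'nd.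
apply: filterS (nbhs_pinfty_gt (num_real LK)) => L hL.
rewrite -subfamily_integral big_enum_val [X in _ = X * _]big_enum_val.
apply: H => //; apply: (aleph_sub _ _ _ _ _ S0 K_nd _ g_aleph).
exact: enum_val_increasing.
Qed.

Lemma aE L : a L ^+ 2 = h L.
Proof.
rewrite /h -rmorphXn /= -powR_mulrn ?powR_ge0// -powRrM.
by rewrite divfK ?pnatr_eq0.
Qed.

Lemma eventually_centered_moment :
  \forall L \near +oo, E L (\prod_(i < n) eta L (K i)) =
    block_integral tg ct v0 [set: 'I_n]%SET (fun v =>
    \sum_(G | spanning G) a L ^+ (#|G|.*2 - n) *
      (\prod_(e in G) CL L e v * \prod_i FL L i v)).
Proof.
apply: filterS2 eventually_moment (nbhs_pinfty_gt (num_real 0)) => L mE L0.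
have a0 : a L != 0 :> R[i] by rewrite (inj_eq (@complexI R)) gt_eqF// powR_gt0.
have nF i : nice ct (FL L i) by have [H _ _] := F_good i; exact: H.
have nC e : e \in edges n -> nice ct (CL L e) by move=> /C_good[H _ _]; exact: H.
have dF i : depends_on (on_block tg [set i]%SET) (FL L i) by exact: dep1.
have dC e : depends_on (on_block tg (edge_verts e)) (CL L e) by exact: dep2.
pose I S := block_integral tg ct v0 S (block_integrand (CL L) (FL L) (h L) S).
(* The mean is the moment of a singleton, for which the product over pairs is empty. *)
have I1 i : E L (xi R (K i)) = c L (K i) * block_integral tg ct v0 [set i]%SET (FL L i).
  have := mE [set i]%SET; rewrite !big_set1 => ->; congr (_ * block_integral _ _ _ _ _).
  apply/funext => v; rewrite /block_integrand !big_set1 big_pred0 ?mul1r// => j.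
  by rewrite inE; case: eqP => // ->; rewrite ltnn.
rewrite expectation_normalized.
transitivity ((a L ^+ n)^-1 * \sum_(S : {set 'I_n}) I S *
    \prod_(i in (~: S)%SET) (- block_integral tg ct v0 [set i]%SET (FL L i))).
  rewrite !big_distrr /=; apply: eq_bigr => S _; rewrite mE.
  rewrite (eq_bigr (fun i => c L (K i) * - block_integral tg ct v0 [set i]%SET (FL L i))
    (P := mem (~: S)%SET)) => [|i _]; last by rewrite I1 mulrN.
  rewrite [X in _ * (_ * X)]big_split /=.
  have -> : \prod_(i < n) (c L (K i) * a L)^-1 = (\prod_(i < n) c L (K i))^-1 * (a L ^+ n)^-1.
    by rewrite prodfV big_split /= prodr_const card_ord invfM.
  have -> : \prod_(i < n) c L (K i) =
      (\prod_(i in S) c L (K i)) * \prod_(i in (~: S)%SET) c L (K i).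
    rewrite (bigID (mem S)) /=; congr (_ * _).
    by apply: eq_bigl => i; rewrite inE.
  have cn (P : pred 'I_n) : \prod_(i | P i) c L (K i) != 0.
    by apply/prodf_neq0 => i _; exact: c_neq0.
  rewrite -/(I S); move: (cn (mem S)) (cn (mem (~: S)%SET)) => /=.
  move: (\prod_(i in S) c L (K i)) (\prod_(i in (~: S)%SET) c L (K i)) => x y x0 y0.
  move: (I S) (\prod_(i in _) _) => z w; rewrite -!mulrA; field.
  by rewrite x0 y0 /= expf_neq0.
rewrite centered_block_integrals//.
rewrite /block_integral -iterated_integralZ//; last first.
  apply: nice_sum => G /andP[/fintype.subsetP GE _]; apply: niceM; first exact: nice_cst.
  by apply: niceM; apply: nice_prod => // e /GE; exact: nC.
congr iterated_integral; apply/funext => v; rewrite big_distrr /=.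
apply: eq_bigr => G /andP[/card_verts + /eqP Gv]; rewrite Gv cardsT card_ord => Gn.
(* Here h^|G| = a^(2|G|) = a^(2|G| - n) a^n, which requires n <= 2|G| since the subtraction is that
   of naturals. *)
rewrite mulrA -aE -exprM mul2n -[in a L ^+ _](subnK Gn) exprD.
by rewrite [X in X * _]mulrC mulfK// expf_neq0.
Qed.

(** The limit is written with initial value 0, as in [family_integral], although the proof works
    from [v0]: each integrand depends on integrated variables only. *)
Lemma family_cvg :
  E L (\prod_(i < n) eta L (K i)) @[L --> +oo] -->
  \sum_(G : {set 'I_n * 'I_n} | spanning G && (#|G|.*2 == n)%N)
    \prod_(e in G) iterated_integral ct (fun v =>
        Crlim (K e.1) (K e.2) (vars v e.1, vars v e.2) *
        Flim (K e.1) (vars v e.1) * Flim (K e.2) (vars v e.2))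
      [seq p <- enum {: T} | tag p \in edge_verts e] (fun=> 0).
Proof.
have a0 : (a L : R[i]) @[L --> +oo] --> (0 : R[i]).
  by rewrite mulNr; apply: powR_decay; rewrite divr_gt0.
have dF i : depends_on (on_block tg [set i]%SET) (FI i) by exact: dep1.
have dC e : depends_on (on_block tg (edge_verts e)) (CI e) by exact: dep2.
rewrite [X in _ --> X](_ : _ =
  \sum_(G : {set 'I_n * 'I_n} | spanning G && (#|G|.*2 == n)%N)
    \prod_(e in G) edge_integral tg ct v0 CI FI e); last first.
  apply: eq_bigr => G _; apply: eq_bigr => e _.
  apply: (iterated_integral_base (tg := tg)) => v w vw.
  have FE j : j \in edge_verts e -> Flim (K j) (vars v j) = Flim (K j) (vars w j).
    by move=> je; exact: (depends_on_F dF je vw).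
  by have := dC e v w vw; rewrite /CI => ->; rewrite !FE// !inE eqxx ?orbT.
apply: cvg_trans (graphs_cvg v0T dF dC F_good C_good a0).
by apply: near_eq_cvg; apply: filterS eventually_centered_moment => L ->.
Qed.

End Family.

(** Stated for any [K] instead of [pair_idx k r]: an edge of a larger family selects the index
    [K (pair_idx i j _)], and no transport between the dependent types of the contours is then
    required. *)
Let cov (K : 'I_2 -> 'I_q) (u : forall i, 'rV[R[i]]_(l (K i))) : R[i] :=
  Crlim (K ord0) (K ord_max) (u ord0, u ord_max) *
  Flim (K ord0) (u ord0) * Flim (K ord_max) (u ord_max).

Lemma pair_cvg (K : 'I_2 -> 'I_q) g : nondecreasing_idx K -> aleph 2%N K g ->
  E L (eta L (K ord0) * eta L (K ord_max)) @[L --> +oo] -->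
  family_integral g (cov K).
Proof.
move=> K_nd g_aleph; have [v0 v0T] := torus_neq0 (family_contour g).
have := family_cvg _ _ _ K_nd g_aleph _ v0T.
rewrite sum_matchings2 big_set1 /= (eq_filter (a2 := predT)); last first.
  by move=> -[[[|[|i]] hi] m]; rewrite !inE.
rewrite filter_predT.
suff -> : (fun L => E L (\prod_(i < 2) eta L (K i))) =
  (fun L => E L (eta L (K ord0) * eta L (K ord_max))) by [].
apply/funext => L; rewrite !big_ord_recl big_ord0 mulr1.
by have -> : ord_max = lift ord0 ord0 :> 'I_2 by exact/val_inj.
Qed.

(* Defined as a limit, the covariance is symmetric and visibly independent of the
   choice of the contours. *)
Definition limit_covariance : 'M[R[i]]_q :=
  \matrix_(k, r) lim (E L (eta L k * eta L r) @[L --> +oo]).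

Lemma limit_covariance_sym : limit_covariance^T = limit_covariance.
Proof.
apply/matrixP => k r; rewrite !mxE.
suff -> : (fun L => E L (eta L r * eta L k)) = (fun L => E L (eta L k * eta L r)) by [].
by apply/funext => L; rewrite mulrC.
Qed.

Lemma limit_covarianceE (K : 'I_2 -> 'I_q) g : nondecreasing_idx K -> aleph 2%N K g ->
  limit_covariance (K ord0) (K ord_max) = family_integral g (cov K).
Proof.
move=> K_nd g_aleph; rewrite mxE; apply: cvg_lim.
  exact: (@norm_hausdorff R[i] R[i]).
exact: pair_cvg.
Qed.

Lemma cvg_nondecreasing n (K : 'I_n -> 'I_q) g : nondecreasing_idx K -> aleph n K g ->
  E L (\prod_(i < n) eta L (K i)) @[L --> +oo] --> gaussian_moment limit_covariance K.
Proof.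
move=> K_nd g_aleph; have [v0 v0T] := torus_neq0 (family_contour g).
have := family_cvg _ _ _ K_nd g_aleph _ v0T.
rewrite [X in _ --> X -> _](_ : _ = gaussian_moment limit_covariance K)//.
rewrite /gaussian_moment.
rewrite [RHS](eq_bigr (fun P => \prod_(e in matching_edges P)
  limit_covariance (K e.1) (K e.2))); last first.
  by move=> P _; apply: eq_bigl => e; rewrite inE.
rewrite (sum_perfect_matching (fun G => \prod_(e in G) limit_covariance (K e.1) (K e.2))).
apply: eq_bigr => G /andP[/andP[/fintype.subsetP GE _] _].
apply: eq_bigr => -[i j] /GE; rewrite inE /= => ij.
have s_incr : {homo pair_idx i j : k m / (k < m)%N}.
  by move=> [[|[|k]] hk] [[|[|m]] hm].
have Kij_nd : nondecreasing_idx (fun k => K (pair_idx i j k)).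
  move=> k m; rewrite leq_eqVlt => /orP[/eqP/val_inj ->//|km].
  by apply/K_nd/ltnW/s_incr.
(* By (3) the edge (i, j) selects a subfamily in [aleph] of dimension two, whose integral is
   therefore the covariance, whatever [g] is. *)
have := limit_covarianceE _ _ Kij_nd (aleph_sub n K 2%N (pair_idx i j) g isT K_nd s_incr g_aleph).
rewrite (family_integral_increasing g _ s_incr) => ->.
congr iterated_integral; apply: eq_filter => p; rewrite !inE.
apply/orP/codomP => [[]/eqP ->|[k ->]].
- by exists ord0.
- by exists ord_max.
- by rewrite /pair_idx; case: k => [[|k] hk]; [left|right].
Qed.

End Assembly.

Theorem lemma4p2 (R : realType) (q : nat) (q_gt0 : (0 < q)%N)
  (* the virtual random variables: a normalized functional for each L *)
  (E : R -> {scalar mpoly q R[i]})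
  (E1 : forall L : R, 0 < L -> E L 1 = 1)
  (* (1) *)
  (l : 'I_q -> nat) (l_gt0 : forall k, (0 < l k)%N)
  (* (2) *)
  (aleph : forall n (K : 'I_n -> 'I_q),
     set (forall i : 'I_n, multicontour R (l (K i))))
  (aleph_neq0 : forall n (K : 'I_n -> 'I_q),
     (0 < n)%N -> nondecreasing_idx K -> aleph n K !=set0)
  (* (3) *)
  (aleph_sub : forall n (K : 'I_n -> 'I_q) t (s : 'I_t -> 'I_n) g,
     (0 < t)%N -> nondecreasing_idx K ->
     {homo s : i j / (i < j)%N} -> aleph n K g ->
     aleph t (fun j => K (s j)) (fun j => g (s j)))
  (* (4) *)
  (F : R -> forall k : 'I_q, 'rV[R[i]]_(l k) -> R[i])
  (Flim : forall k : 'I_q, 'rV[R[i]]_(l k) -> R[i])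
  (F_cont : forall n (K : 'I_n -> 'I_q) g (i : 'I_n) (L : R),
     nondecreasing_idx K -> aleph n K g -> 0 < L ->
     {within mtrace (g i), continuous (F L (K i))})
  (Flim_cont : forall n (K : 'I_n -> 'I_q) g (i : 'I_n),
     nondecreasing_idx K -> aleph n K g ->
     {within mtrace (g i), continuous (Flim (K i))})
  (F_cvg : forall n (K : 'I_n -> 'I_q) g (i : 'I_n),
     nondecreasing_idx K -> aleph n K g ->
     {uniform mtrace (g i), F L (K i) @[L --> +oo] --> Flim (K i)})
  (* (5) *)
  (Cr : R -> forall k r : 'I_q, 'rV[R[i]]_(l k) * 'rV[R[i]]_(l r) -> R[i])
  (Crlim : forall k r : 'I_q, 'rV[R[i]]_(l k) * 'rV[R[i]]_(l r) -> R[i])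
  (Cr_cont : forall n (K : 'I_n -> 'I_q) g (i j : 'I_n) (L : R),
     nondecreasing_idx K -> aleph n K g -> (i < j)%N -> 0 < L ->
     {within mtrace (g i) `*` mtrace (g j), continuous (Cr L (K i) (K j))})
  (Crlim_cont : forall n (K : 'I_n -> 'I_q) g (i j : 'I_n),
     nondecreasing_idx K -> aleph n K g -> (i < j)%N ->
     {within mtrace (g i) `*` mtrace (g j), continuous (Crlim (K i) (K j))})
  (Cr_cvg : forall n (K : 'I_n -> 'I_q) g (i j : 'I_n),
     nondecreasing_idx K -> aleph n K g -> (i < j)%N ->
     {uniform mtrace (g i) `*` mtrace (g j),
       Cr L (K i) (K j) @[L --> +oo] --> Crlim (K i) (K j)})
  (* (6) *)
  (c : R -> 'I_q -> R[i]) (c_neq0 : forall L k, 0 < L -> c L k != 0)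
  (* (7) *)
  (gamma : R) (gamma_gt0 : 0 < gamma)
  (* the moment formula *)
  (moment_formula : forall n (K : 'I_n -> 'I_q),
     (0 < n)%N -> nondecreasing_idx K ->
     exists2 LK : R, 0 < LK & forall L, LK < L -> forall g, aleph n K g ->
       E L (\prod_(i < n) xi R (K i)) =
       (\prod_(i < n) c L (K i)) *
       family_integral g (moment_integrand (F L) (Cr L) (L `^ (- gamma)) (K := K))) :
  exists Sigma : 'M[R[i]]_q,
    [/\ Sigma^T = Sigma,
        forall k r : 'I_q, (k <= r)%N -> forall g, aleph 2%N (pair_idx k r) g ->
          Sigma k r = family_integral g (covariance_integrand Flim Crlim (k := k) (r := r))
      & cvg_gaussian_moments E
          (fun L k => normalized (E L) (c L k * (L `^ (- gamma / 2))%:C) k)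
          Sigma].

Proof.
have sym := limit_covariance_sym R q E c gamma.
exists (limit_covariance R q E c gamma); split=> // [k r kr g g_aleph|].
  have K_nd : nondecreasing_idx (pair_idx k r).
    by move=> [[|[|i]] hi] [[|[|j]] hj].
  exact: (limit_covarianceE R q E E1 l aleph aleph_sub F Flim F_cont Flim_cont F_cvg
    Cr Crlim Cr_cont Crlim_cont Cr_cvg c c_neq0 gamma gamma_gt0 moment_formula
    (pair_idx k r) g K_nd g_aleph).
move=> [|n] K.
  (* The moment of order 0 lies outside the moment formula. The empty partition is the only matching
     and contributes an empty product, to be compared with [E L 1 = 1]. *)
  rewrite /gaussian_moment (big_pred1 finset.set0) => [|P]; last first.
    rewrite /perfect_matching (_ : [set: 'I_0]%SET = finset.set0); last first.
      by apply/setP => -[].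
    rewrite partition_set0 /=; have [->|//] := eqVneq P finset.set0.
    by apply/forall_inP => B; rewrite inE.
  rewrite big1 => [|[[]]//]; apply/cvg_nlP => e e0.
  apply: filterS (nbhs_pinfty_gt (num_real 0)) => L L0.
  by rewrite big_ord0 E1// subrr nl0.
have [s K_nd] := sorting_permutation K.
have [g g_aleph] := aleph_neq0 n.+1 _ isT K_nd.
rewrite -(gaussian_moment_perm K s sym).
have := cvg_nondecreasing R q E E1 l aleph aleph_sub F Flim F_cont Flim_cont F_cvg
    Cr Crlim Cr_cont Crlim_cont Cr_cvg c c_neq0 gamma gamma_gt0 moment_formula
    n.+1 _ g K_nd g_aleph.
apply: cvg_trans; apply: near_eq_cvg; apply: nearW => L.
(* Polynomials commute, so the moment is unchanged by sorting the index. *)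
by congr (E L _); rewrite [RHS](reindex_perm s).
Qed.
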